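(* Let $p$ be a prime, let $q$ be a power of $p$, and let $n$ and $r$ be positive integers. Let $\mathbf{G}$ be either $\mathrm{GL}_n$ or $\mathrm{SL}_n$, and let $F$ be a perfect field of the same characteristic $p$ as $\mathbb{F}_q$. Given $p\geq n$, the group algebras $F[\mathbf{G}(W_r(\mathbb{F}_q))]$ and $F[\mathbf{G}(\mathbb{F}_q[t]/t^r)]$ are not stably equivalent of Morita type when: \begin{itemize} \item $r=2$ and $p\geq 2n$; \item $r=3$ and $p\geq 3$; \item $r\geq 4$ and $p\geq 2$. \end{itemize}
   Context: $\mathbb{F}_q$ is the finite field with $q$ elements, and $W_r(\mathbb{F}_q)$ denotes the ring of Witt vectors of length $r$ with residue field $\mathbb{F}_q$. For a finite group $G$, $F[G]$ is its group algebra over $F$. Stable equivalence of Morita type: let $A$ and $B$ be $F$-algebras, let $M$ be a $B$-$A$-bimodule and $N$ an $A$-$B$-bimodule such that (1) $M$ is projective as a $B$-module and as an $A^{op}$-module, and $N$ is projective as a $B^{op}$-module and as an $A$-module; (2) $M\otimes_A N\simeq B\oplus Q$ as $B$-$B$-bimodules, where $Q$ is a finitely generated projective $B$-$B$-bimodule, and $N\otimes_B M\simeq A\oplus P$ as $A$-$A$-bimodules, where $P$ is a finitely generated projective $A$-$A$-bimodule. Then $(M,N)$ is said to induce a stable equivalence of Morita type between $A$ and $B$. The algebras $A$ and $B$ are stably equivalent of Morita type if such a pair $(M,N)$ exists.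
   Formalization: For n = 1 the cases where the two groups are isomorphic, so that the claim fails, are excluded: SL_1; GL_1 with r = 2; and GL_1 with q = 2 and r = 4 or 5. Nothing is excluded for n ≥ 2. *)

(* Defs.v *)
From HB Require Import structures.
From mathcomp Require Import all_boot all_order all_fingroup all_algebra.
From mathcomp Require Import qfpoly ring.
From mathcomp.multinomials Require Import mpoly.
Set Implicit Arguments.
Unset Strict Implicit.
Unset Printing Implicit Defensive.
Import Order.TTheory GRing.Theory Num.Theory.
Local Open Scope ring_scope.

(* The n-th Witt polynomial w_n = sum_(i <= n) p^i X_i^(p^(n-i)), evaluated at
   the sequence x. *)
Definition ghost (p : nat) (A : comNzRingType) (x : nat -> A) (n : nat) : A :=
  \sum_(i < n.+1) x i ^+ (p ^ (n - i)) *+ p ^ i.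

Section Ghost.
Variable p : nat.
Hypothesis p_pr : prime p.

Lemma eq_ghost (A : comNzRingType) (x y : nat -> A) n :
  (forall i, (i <= n)%N -> x i = y i) -> ghost p x n = ghost p y n.
Proof. by move=> e; apply: eq_bigr => i _; rewrite e // -ltnS. Qed.

Lemma rmorph_ghost (A B : comNzRingType) (f : {rmorphism A -> B}) x n :
  f (ghost p x n) = ghost p (f \o x) n.
Proof.
by rewrite rmorph_sum; apply: eq_bigr => i _; rewrite rmorphMn rmorphXn.
Qed.

Lemma ghostS (A : comNzRingType) (x : nat -> A) n :
  ghost p x n =
  \sum_(i < n) x i ^+ (p ^ (n - i)) *+ p ^ i + x n *+ p ^ n.
Proof. by rewrite /ghost big_ord_recr /= subnn expr1. Qed.

Lemma ghost_inj (A : comNzRingType) (x y : nat -> A) r :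
  (forall n (a : A), a *+ p ^ n = 0 -> a = 0) ->
  (forall n, (n < r)%N -> ghost p x n = ghost p y n) ->
  forall n, (n < r)%N -> x n = y n.
Proof.
move=> tf e n; elim/ltn_ind: n => n IH ltnr.
have := e n ltnr; rewrite !ghostS.
rewrite (eq_bigr (fun i : 'I_n => y i ^+ (p ^ (n - i)) *+ p ^ i)); last first.
  by move=> i _; rewrite IH // (ltn_trans _ ltnr).
move/addrI => {}e; apply/subr0_eq/(tf n).
by rewrite mulrnBl e subrr.
Qed.

Definition eqmodn (A : comNzRingType) (d : nat) (a b : A) :=
  exists c, a = b + c *+ d.

Section Eqmodn.
Variable A : comNzRingType.
Implicit Types a b c : A.

Lemma eqmodn_refl d a : eqmodn d a a.
Proof. by exists 0; rewrite mul0rn addr0. Qed.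
Lemma eqmodn_sym d a b : eqmodn d a b -> eqmodn d b a.
Proof. by case=> c ->; exists (- c); rewrite mulNrn addrK. Qed.
Lemma eqmodn_trans d a b c : eqmodn d a b -> eqmodn d b c -> eqmodn d a c.
Proof. by move=> [u ->] [v ->]; exists (v + u); rewrite mulrnDl addrA. Qed.
Lemma eqmodnD d a b a' b' :
  eqmodn d a b -> eqmodn d a' b' -> eqmodn d (a + a') (b + b').
Proof. by move=> [u ->] [v ->]; exists (u + v); rewrite mulrnDl addrACA. Qed.
Lemma eqmodnN d a b : eqmodn d a b -> eqmodn d (- a) (- b).
Proof. by move=> [u ->]; exists (- u); rewrite mulNrn opprD. Qed.
Lemma eqmodnM d a b a' b' :
  eqmodn d a b -> eqmodn d a' b' -> eqmodn d (a * a') (b * b').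
Proof.
move=> [u ->] [v ->]; exists (u * b' + b * v + (u * v) *+ d).
rewrite mulrDl !mulrDr !mulrnDl !mulrnAl !mulrnAr -!addrA; congr (_ + _).
by rewrite addrCA !addrA.
Qed.
Lemma eqmodnX d a b k : eqmodn d a b -> eqmodn d (a ^+ k) (b ^+ k).
Proof.
move=> e; elim: k => [|k IH]; first by rewrite !expr0; exact: eqmodn_refl.
by rewrite !exprS; exact: eqmodnM.
Qed.
Lemma eqmodnMn d e a b : eqmodn d a b -> eqmodn (e * d) (a *+ e) (b *+ e).
Proof. by move=> [u ->]; exists u; rewrite mulrnDl mulnC mulrnA. Qed.
Lemma eqmodn_sum d (I : Type) (s : seq I) (P : pred I) (f g : I -> A) :
  (forall i, P i -> eqmodn d (f i) (g i)) ->
  eqmodn d (\sum_(i <- s | P i) f i) (\sum_(i <- s | P i) g i).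
Proof.
move=> e; apply: (big_ind2 (eqmodn d)) => //; first exact: eqmodn_refl.
exact: eqmodnD.
Qed.

Lemma eqmodn_exprD a b : eqmodn p ((a + b) ^+ p) (a ^+ p + b ^+ p).
Proof.
have p0 := prime_gt0 p_pr.
rewrite exprDn -(prednK p0) big_ord_recr big_ord_recl /= !prednK //.
rewrite subnn !expr0 subn0 bin0 binn !mulr1n mul1r mulr1 addrAC addrC.
rewrite -[X in eqmodn _ _ X]add0r; apply: eqmodnD; last exact: eqmodn_refl.
have {2}-> : 0 = \sum_(i < p.-1) 0 :> A by rewrite big1_eq.
apply: eqmodn_sum => i _.
have lti : (0 < bump 0 i < p)%N by rewrite /bump leq0n add1n /= -ltn_predRL.
have /dvdnP[k ->] := prime_dvd_bin p_pr lti.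
by exists (a ^+ (p - bump 0 i) * b ^+ bump 0 i *+ k); rewrite add0r mulrnA.
Qed.

Lemma eqmodn_exprp k a b : (0 < k)%N ->
  eqmodn (p ^ k) a b -> eqmodn (p ^ k.+1) (a ^+ p) (b ^+ p).
Proof.
case: k => // k _ [c e].
have ep : eqmodn p a b by exists (c *+ p ^ k); rewrite e -mulrnA -expnSr.
have [v ev] : eqmodn p (\sum_(i < p) a ^+ (p.-1 - i) * b ^+ i) 0.
  apply: (@eqmodn_trans _ _ (\sum_(i < p) b ^+ p.-1)).
    apply: eqmodn_sum => i _.
    have -> : b ^+ p.-1 = b ^+ (p.-1 - i) * b ^+ i.
      by rewrite -exprD subnK // -ltnS prednK ?prime_gt0.
    by apply: eqmodnM (eqmodn_refl _ _); apply: eqmodnX.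
  by rewrite sumr_const card_ord; exists (b ^+ p.-1); rewrite add0r.
exists (c * v); apply/eqP; rewrite addrC -subr_eq subrXX ev add0r e.
by rewrite [b + _]addrC addrK mulrnAl mulrnAr -mulrnA -expnS.
Qed.

Lemma eqmodn_exprpn k j a b : (0 < k)%N ->
  eqmodn (p ^ k) a b -> eqmodn (p ^ (k + j)) (a ^+ (p ^ j)) (b ^+ (p ^ j)).
Proof.
move=> k0 e; elim: j => [|j IH]; first by rewrite addn0 !expr1.
rewrite addnS [(p ^ j.+1)%N]expnSr !exprM; apply: eqmodn_exprp IH.
by rewrite addn_gt0 k0.
Qed.
End Eqmodn.

Section Unghost.
Variable m : nat.
Local Notation P := {mpoly int[m]}.

(* Coefficientwise Euclidean quotient by d; only used when d divides f. *)
Definition mdivn (d : nat) (f : P) : P :=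
  \sum_(u <- msupp f) ((f@_u %/ d)%Z *: 'X_[u]).

Lemma mdivnK d (f : P) : (0 < d)%N -> mdivn d (f *+ d) = f.
Proof.
move=> d0; rewrite /mdivn -scaler_nat.
have dn0 : (d%:R : int) != 0 by rewrite pnatr_eq0 -lt0n.
rewrite (perm_big _ (msuppZ f dn0)) /= [RHS]mpolyE.
apply: eq_bigr => u _; rewrite mcoeffZ mulrC natz mulzK //.
by rewrite -natz.
Qed.

Lemma mpoly_tf n (a : P) : a *+ p ^ n = 0 -> a = 0.
Proof.
move=> e; have d0 : (0 < p ^ n)%N by rewrite expn_gt0 prime_gt0.
by rewrite -(mdivnK a d0) e /mdivn msupp0 big_nil.
Qed.

(* The Witt coordinates of a ghost sequence y over Z[X_1..X_m], i.e. the solution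
   x of w_n(x) = y_n, solved recursively in n.  The divisions by p^n are exact
   as soon as y satisfies Dwork's congruences: see ghost_unghost. *)
Fixpoint unghost_seq (y : nat -> P) (n : nat) : seq P :=
  if n is n'.+1 then
    let s := unghost_seq y n' in
    rcons s (mdivn (p ^ n')
      (y n' - \sum_(i < n') s`_i ^+ (p ^ (n' - i)) *+ p ^ i))
  else [::].

Definition unghost (y : nat -> P) (n : nat) : P := (unghost_seq y n.+1)`_n.

Lemma size_unghost y n : size (unghost_seq y n) = n.
Proof. by elim: n => //= n IH; rewrite size_rcons IH. Qed.

Lemma nth_unghost y n i : (i < n)%N -> (unghost_seq y n)`_i = unghost y i.
Proof.
elim: n => // n IH; rewrite ltnS leq_eqVlt => /orP[/eqP ->//|lt].
by rewrite /= nth_rcons size_unghost lt IH.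
Qed.

Lemma unghostE y n : unghost y n = 
  mdivn (p ^ n) (y n - \sum_(i < n) unghost y i ^+ (p ^ (n - i)) *+ p ^ i).
Proof.
rewrite {1}/unghost /= nth_rcons size_unghost ltnn eqxx; congr (mdivn _ (_ - _)).
by apply: eq_bigr => i _; rewrite nth_unghost.
Qed.

(* The Frobenius lift X_i |-> X_i^p. *)
Definition frob : P -> P := mmap (@mpolyC m int) (fun i => 'X_i ^+ p).
HB.instance Definition _ := GRing.RMorphism.on frob.

Lemma frobP f : eqmodn p (frob f) (f ^+ p).
Proof.
have C c : eqmodn p (c : int)%:MP_[m] (c%:MP_[m] ^+ p).
  have N k : eqmodn p (k%:R : P) (k%:R ^+ p).
    elim: k => [|k IH]; first by rewrite expr0n gtn_eqF ?prime_gt0 //; apply: eqmodn_refl.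
    rewrite -natr1; apply: eqmodn_trans (eqmodn_sym (eqmodn_exprD _ _)).
    by rewrite expr1n; apply: eqmodnD (eqmodn_refl _ _).
  have -> : c%:MP_[m] = c%:~R :> P by rewrite -[in LHS](intz c) rmorph_int.
  case: c => k; first exact: N.
  rewrite NegzE mulrNz; apply: (@eqmodn_trans _ _ _ (- (k.+1%:R ^+ p))).
    apply: eqmodnN; exact: N.
  apply: (@eqmodn_trans _ _ _ ((-1) ^+ p * (k.+1%:R ^+ p))); last first.
    by rewrite -exprMn mulN1r; exact: eqmodn_refl.
  rewrite -mulN1r; apply: eqmodnM (eqmodn_refl _ _).
  have [->|o] := even_prime p_pr; last by rewrite -signr_odd o; exact: eqmodn_refl.
  by rewrite sqrrN expr1n; exists (-1); rewrite mulrS mulr1n addrA subrr add0r.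
elim/mpolyind: f => [|c u f _ _ IH].
  by rewrite raddf0 expr0n gtn_eqF ?prime_gt0 //; apply: eqmodn_refl.
rewrite rmorphD; apply: eqmodn_trans (eqmodn_sym (eqmodn_exprD _ _)).
apply: eqmodnD => //; rewrite -mul_mpolyC rmorphM exprMn; apply: eqmodnM.
  by rewrite /= /frob mmapC; have := C c; rewrite ?mmapC.
rewrite /= /frob mmapX /mmap1 mpolyXE_id -prodrXl.
by under eq_bigr do rewrite -exprM mulnC exprM; exact: eqmodn_refl.
Qed.

Definition dwork (y : nat -> P) :=
  forall n, eqmodn (p ^ n.+1) (y n.+1) (frob (y n)).

Lemma ghost_unghost y : dwork y -> forall n, ghost p (unghost y) n = y n.
Proof.
move=> dy n; elim/ltn_ind: n => n IH; rewrite ghostS unghostE.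
set s := \sum_(i < n) _; suff [c e] : eqmodn (p ^ n) (y n) s.
  by rewrite e (addrAC s) subrr add0r mdivnK ?expn_gt0 ?prime_gt0.
case: n @s IH => [|n] s IH; first by exists (y 0%N - s); rewrite expn0 mulr1n addrC subrK.
apply: eqmodn_trans (dy n) _; rewrite -(IH n) // rmorph_ghost.
apply: eqmodn_sum => i _.
have lin : (i <= n)%N by rewrite -ltnS.
rewrite subSn // [in X in eqmodn X](_ : p ^ n.+1 = p ^ i * p ^ (1 + (n - i)))%N.
  apply: eqmodnMn; rewrite [in X in eqmodn _ _ X]expnS exprM.
  apply: eqmodn_exprpn => //; rewrite expn1; exact: frobP.
by rewrite -expnD add1n addnS subnKC.
Qed.

Lemma dworkD y z : dwork y -> dwork z -> dwork (fun n => y n + z n).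
Proof. by move=> dy dz n; rewrite rmorphD; exact: eqmodnD. Qed.
Lemma dworkN y : dwork y -> dwork (fun n => - y n).
Proof. by move=> dy n; rewrite rmorphN; exact: eqmodnN. Qed.
Lemma dworkM y z : dwork y -> dwork z -> dwork (fun n => y n * z n).
Proof. by move=> dy dz n; rewrite rmorphM; exact: eqmodnM. Qed.
Lemma dwork_ghost x : (forall i, frob (x i) = x i ^+ p) -> dwork (ghost p x).
Proof.
move=> ex n; rewrite rmorph_ghost ghostS.
exists (x n.+1); congr (_ + _); apply: eq_bigr => i _ /=.
by rewrite ex -exprM -expnS -subSn // -ltnS.
Qed.
End Unghost.
End Ghost.

(* Witt vectors of length r over a commutative ring A are r-tuples of elements of
   A, added and multiplied with the universal polynomials witt_addp and witt_mulp
   over Z in the 2r variables X_i, Y_i, determined by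
     w_n(S) = w_n(X) + w_n(Y)  and  w_n(P) = w_n(X) w_n(Y)
   (lemmas ghost_addp and ghost_mulp).  As for 'GL_n, the length is written
   r.-1.+1 so that the ring is nontrivial by construction; it is r for r > 0. *)

Section WittVariables.
Variable r : nat.
Local Notation R := r.-1.+1.

Definition wittX (i : nat) : {mpoly int[R + R]} := 'X_(lshift R (inord i)).
Definition wittY (i : nat) : {mpoly int[R + R]} := 'X_(rshift R (inord i)).
End WittVariables.

(* These are locked because unification would otherwise unfold the polynomials. *)
HB.lock Definition witt_addp (p r : nat) : nat -> {mpoly int[r.-1.+1 + r.-1.+1]} :=
  unghost p (fun n => ghost p (wittX r) n + ghost p (wittY r) n).
HB.lock Definition witt_mulp (p r : nat) : nat -> {mpoly int[r.-1.+1 + r.-1.+1]} :=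
  unghost p (fun n => ghost p (wittX r) n * ghost p (wittY r) n).
HB.lock Definition witt_oppp (p r : nat) : nat -> {mpoly int[r.-1.+1 + r.-1.+1]} :=
  unghost p (fun n => - ghost p (wittX r) n).

Definition witt_eval (r : nat) (A : comNzRingType)
    (a b : {ffun 'I_r.-1.+1 -> A}) : {mpoly int[r.-1.+1 + r.-1.+1]} -> A :=
  mmap intr (fun i => match split i with inl j => a j | inr j => b j end).

HB.lock Definition witt_add_fun (p r : nat) (A : comNzRingType)
    (a b : {ffun 'I_r.-1.+1 -> A}) :=
  [ffun i : 'I_r.-1.+1 => witt_eval a b (witt_addp p r i)].
HB.lock Definition witt_mul_fun (p r : nat) (A : comNzRingType)
    (a b : {ffun 'I_r.-1.+1 -> A}) :=
  [ffun i : 'I_r.-1.+1 => witt_eval a b (witt_mulp p r i)].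
HB.lock Definition witt_opp_fun (p r : nat) (A : comNzRingType)
    (a : {ffun 'I_r.-1.+1 -> A}) :=
  [ffun i : 'I_r.-1.+1 => witt_eval a 0 (witt_oppp p r i)].
Definition witt_one_fun (r : nat) (A : comNzRingType) :=
  [ffun i : 'I_r.-1.+1 => (i == 0 :> nat)%:R : A].

HB.lock Definition wghost (p r : nat) (A : comNzRingType)
    (a : {ffun 'I_r.-1.+1 -> A}) (n : nat) : A :=
  ghost p (fun i => a (inord i)) n.

Section WittPolynomials.
Variables (p r : nat).
Local Notation R := r.-1.+1.
Local Notation P := {mpoly int[R + R]}.
Local Notation wittX := (wittX r).
Local Notation wittY := (wittY r).
Local Notation witt_addp := (witt_addp p r).
Local Notation witt_mulp := (witt_mulp p r).
Local Notation witt_oppp := (witt_oppp p r).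
Local Notation wghost := (wghost p (r := r)).
Local Notation witt_add_fun := (witt_add_fun p (r := r)).
Local Notation witt_mul_fun := (witt_mul_fun p (r := r)).
Local Notation witt_opp_fun := (witt_opp_fun p (r := r)).
Local Notation witt_one_fun := (witt_one_fun r).

Hypothesis p_pr : prime p.

Lemma dwork_wittX : dwork p (ghost p wittX).
Proof. by apply: dwork_ghost => i; rewrite /= /frob mmapX mmap1U. Qed.
Lemma dwork_wittY : dwork p (ghost p wittY).
Proof. by apply: dwork_ghost => i; rewrite /= /frob mmapX mmap1U. Qed.

Lemma ghost_addp n :
  ghost p witt_addp n = ghost p wittX n + ghost p wittY n.
Proof.
by rewrite unlock ghost_unghost //; apply: dworkD; [apply: dwork_wittX | apply: dwork_wittY].
Qed.
Lemma ghost_mulp n :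
  ghost p witt_mulp n = ghost p wittX n * ghost p wittY n.
Proof.
by rewrite unlock ghost_unghost //; apply: dworkM; [apply: dwork_wittX | apply: dwork_wittY].
Qed.
Lemma ghost_oppp n : ghost p witt_oppp n = - ghost p wittX n.
Proof. by rewrite unlock ghost_unghost //; apply/dworkN/dwork_wittX. Qed.

Section Ring.
Variable A : comNzRingType.
Implicit Types a b : {ffun 'I_R -> A}.

HB.instance Definition _ a b := GRing.RMorphism.on (witt_eval a b).

Lemma witt_evalD a b f g :
  witt_eval a b (f + g) = witt_eval a b f + witt_eval a b g.
Proof. exact: rmorphD. Qed.
Lemma witt_evalM a b f g :
  witt_eval a b (f * g) = witt_eval a b f * witt_eval a b g.
Proof. exact: rmorphM. Qed.
Lemma witt_evalN a b f : witt_eval a b (- f) = - witt_eval a b f.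
Proof. exact: rmorphN. Qed.

Lemma wghost_eval a b (f : nat -> P) n : (n < R)%N ->
  wghost [ffun i : 'I_R => witt_eval a b (f i)] n = witt_eval a b (ghost p f n).
Proof.
move=> nR; rewrite wghost.unlock rmorph_ghost; apply: eq_ghost => i ilen.
by rewrite ffunE /= inordK // (leq_ltn_trans ilen).
Qed.
Lemma witt_evalX a b n : witt_eval a b (ghost p wittX n) = wghost a n.
Proof.
rewrite wghost.unlock rmorph_ghost; apply: eq_ghost => i _ /=.
by rewrite /witt_eval mmapX mmap1U (unsplitK (inl _)).
Qed.
Lemma witt_evalY a b n : witt_eval a b (ghost p wittY n) = wghost b n.
Proof.
rewrite wghost.unlock rmorph_ghost; apply: eq_ghost => i _ /=.
by rewrite /witt_eval mmapX mmap1U (unsplitK (inr _)).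
Qed.

Lemma wghostD a b n : (n < R)%N ->
  wghost (witt_add_fun a b) n = wghost a n + wghost b n.
Proof.
move=> nR; rewrite witt_add_fun.unlock (wghost_eval _ _ _ nR) ghost_addp witt_evalD.
by congr (_ + _); [apply: witt_evalX | apply: witt_evalY].
Qed.
Lemma wghostM a b n : (n < R)%N ->
  wghost (witt_mul_fun a b) n = wghost a n * wghost b n.
Proof.
move=> nR; rewrite witt_mul_fun.unlock (wghost_eval _ _ _ nR) ghost_mulp witt_evalM.
by congr (_ * _); [apply: witt_evalX | apply: witt_evalY].
Qed.
Lemma wghostN a n : (n < R)%N -> wghost (witt_opp_fun a) n = - wghost a n.
Proof.
move=> nR; rewrite witt_opp_fun.unlock (wghost_eval _ _ _ nR) ghost_oppp witt_evalN.
by congr (- _); apply: witt_evalX.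
Qed.
Lemma wghost0 n : wghost (0 : {ffun 'I_R -> A}) n = 0.
Proof.
rewrite wghost.unlock /ghost big1 // => i _; rewrite ffunE expr0n.
by rewrite gtn_eqF ?expn_gt0 ?prime_gt0 // mul0rn.
Qed.
Lemma wghost1 n : (n < R)%N -> wghost (witt_one_fun A) n = 1.
Proof.
move=> nR; rewrite wghost.unlock /ghost big_ord_recl ffunE inordK // eqxx expr1n mulr1n.
rewrite big1 ?addr0 // => i _; rewrite ffunE inordK /=; last first.
  by rewrite /bump leq0n add1n (leq_ltn_trans _ nR).
by rewrite expr0n gtn_eqF ?expn_gt0 ?prime_gt0 // mul0rn.
Qed.
End Ring.

Definition wmap (A B : Type) (g : A -> B) (a : {ffun 'I_R -> A}) :=
  [ffun i => g (a i)].

Section Natural.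
Variables (A B : comNzRingType) (g : {rmorphism A -> B}).
Implicit Types a b : {ffun 'I_R -> A}.

Lemma witt_eval_nat a b f : g (witt_eval a b f) = witt_eval (wmap g a) (wmap g b) f.
Proof.
rewrite /witt_eval /mmap rmorph_sum; apply: eq_bigr => u _.
rewrite rmorphM rmorph_int; congr (_ * _); rewrite /mmap1 rmorph_prod.
apply: eq_bigr => i _; rewrite rmorphXn; congr (_ ^+ _).
by case: split => j; rewrite ffunE.
Qed.
Lemma wmap0 : wmap g (0 : {ffun 'I_R -> A}) = 0.
Proof. by apply/ffunP => i; rewrite !ffunE rmorph0. Qed.
Lemma wmap1 : wmap g (witt_one_fun A) = witt_one_fun B.
Proof. by apply/ffunP => i; rewrite !ffunE rmorph_nat. Qed.
Lemma wmapD a b : wmap g (witt_add_fun a b) = witt_add_fun (wmap g a) (wmap g b).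
Proof. by rewrite !witt_add_fun.unlock; apply/ffunP => i; rewrite !ffunE witt_eval_nat. Qed.
Lemma wmapM a b : wmap g (witt_mul_fun a b) = witt_mul_fun (wmap g a) (wmap g b).
Proof. by rewrite !witt_mul_fun.unlock; apply/ffunP => i; rewrite !ffunE witt_eval_nat. Qed.
Lemma wmapN a : wmap g (witt_opp_fun a) = witt_opp_fun (wmap g a).
Proof. by rewrite !witt_opp_fun.unlock; apply/ffunP => i; rewrite !ffunE witt_eval_nat wmap0. Qed.
End Natural.

Lemma wghost_inj N (x y : {ffun 'I_R -> {mpoly int[N]}}) :
  (forall n, (n < R)%N -> wghost x n = wghost y n) -> x = y.
Proof.
move=> e; apply/ffunP => i.
rewrite wghost.unlock in e.
have := ghost_inj (mpoly_tf p_pr (m := N)) e (ltn_ord i).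
by rewrite inord_val.
Qed.

Lemma witt_lift (A : comNzRingType) (a b c : {ffun 'I_R -> A}) :
  exists N (g : {rmorphism {mpoly int[N]} -> A}) x y z,
  [/\ a = wmap g x, b = wmap g y & c = wmap g z].
Proof.
pose I := ('I_3 * 'I_R)%type; exists #|{: I}|.
pose h (i : 'I_#|{: I}|) : A :=
  let u := enum_val i in (tnth [tuple a; b; c] u.1) u.2.
pose v (k : 'I_3) : {ffun 'I_R -> {mpoly int[#|{: I}|]}} :=
  [ffun j => 'X_(enum_rank ((k, j) : I))].
exists (mmap intr h : {rmorphism {mpoly int[#|{: I}|]} -> A}).
exists (v ord0), (v (inord 1)), (v (inord 2)).
by split; apply/ffunP => i; rewrite !ffunE /= mmapX mmap1U /h enum_rankK /=
  ?(tnth_nth 0) ?inordK.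
Qed.

End WittPolynomials.

(* p_pr is a phantom argument: the ring axioms depend on the primality of p. *)
Record witt (p : nat) (p_pr : prime p) (r : nat) (A : Type) :=
  Witt { wcoord : {ffun 'I_r.-1.+1 -> A} }.

Section WittRing.
Variables (p : nat) (p_pr : prime p) (r : nat).
Local Notation W := (witt p_pr r).
HB.instance Definition _ A := [isNew for @wcoord p p_pr r A].
HB.instance Definition _ (A : eqType) := [Equality of W A by <:].
HB.instance Definition _ (A : choiceType) := [Choice of W A by <:].
HB.instance Definition _ (A : countType) := [Countable of W A by <:].
HB.instance Definition _ (A : finType) := [Finite of W A by <:].

Variable A : comNzRingType.
Implicit Types a b c : W A.

Definition witt_zero : W A := Witt p_pr 0.
Definition witt_one : W A := Witt p_pr (witt_one_fun r A).
Definition witt_opp a : W A := Witt p_pr (witt_opp_fun p (wcoord a)).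
Definition witt_add a b : W A :=
  Witt p_pr (witt_add_fun p (wcoord a) (wcoord b)).
Definition witt_mul a b : W A :=
  Witt p_pr (witt_mul_fun p (wcoord a) (wcoord b)).

Fact witt_addA : associative witt_add.
Proof. move=> a b c; apply: val_inj; rewrite /= ?/witt_zero ?/witt_one /=;
have [N [g [x [y [z [-> -> ->]]]]]] := witt_lift (wcoord a) (wcoord b) (wcoord c);
rewrite -?(@wmap0 _ _ _ g) -?(@wmap1 _ _ _ g) -?(wmapN, wmapD, wmapM);
apply: (congr1 (wmap g)); apply: (wghost_inj p_pr) => n nR;
rewrite !(wghostN, wghostD, wghostM, wghost0, wghost1) //.
exact: addrA. Qed.
Fact witt_addC : commutative witt_add.
Proof. move=> a b; apply: val_inj; rewrite /= ?/witt_zero ?/witt_one /=;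
have [N [g [x [y [z [-> -> _]]]]]] := witt_lift (wcoord a) (wcoord b) (wcoord a);
rewrite -?(@wmap0 _ _ _ g) -?(@wmap1 _ _ _ g) -?(wmapN, wmapD, wmapM);
apply: (congr1 (wmap g)); apply: (wghost_inj p_pr) => n nR;
rewrite !(wghostN, wghostD, wghostM, wghost0, wghost1) //.
exact: addrC. Qed.
Fact witt_add0 : left_id witt_zero witt_add.
Proof. move=> a; apply: val_inj; rewrite /= ?/witt_zero ?/witt_one /=;
have [N [g [x [y [z [-> _ _]]]]]] := witt_lift (wcoord a) (wcoord a) (wcoord a);
rewrite -?(@wmap0 _ _ _ g) -?(@wmap1 _ _ _ g) -?(wmapN, wmapD, wmapM);
apply: (congr1 (wmap g)); apply: (wghost_inj p_pr) => n nR;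
rewrite !(wghostN, wghostD, wghostM, wghost0, wghost1) //.
exact: add0r. Qed.
Fact witt_addN : left_inverse witt_zero witt_opp witt_add.
Proof. move=> a; apply: val_inj; rewrite /= ?/witt_zero ?/witt_one /=;
have [N [g [x [y [z [-> _ _]]]]]] := witt_lift (wcoord a) (wcoord a) (wcoord a);
rewrite -?(@wmap0 _ _ _ g) -?(@wmap1 _ _ _ g) -?(wmapN, wmapD, wmapM);
apply: (congr1 (wmap g)); apply: (wghost_inj p_pr) => n nR;
rewrite !(wghostN, wghostD, wghostM, wghost0, wghost1) //.
exact: addNr. Qed.
HB.instance Definition _ :=
  GRing.isZmodule.Build (W A) witt_addA witt_addC witt_add0 witt_addN.

Fact witt_mulA : associative witt_mul.
Proof. move=> a b c; apply: val_inj; rewrite /= ?/witt_zero ?/witt_one /=;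
have [N [g [x [y [z [-> -> ->]]]]]] := witt_lift (wcoord a) (wcoord b) (wcoord c);
rewrite -?(@wmap0 _ _ _ g) -?(@wmap1 _ _ _ g) -?(wmapN, wmapD, wmapM);
apply: (congr1 (wmap g)); apply: (wghost_inj p_pr) => n nR;
rewrite !(wghostN, wghostD, wghostM, wghost0, wghost1) //.
exact: mulrA. Qed.
Fact witt_mulC : commutative witt_mul.
Proof. move=> a b; apply: val_inj; rewrite /= ?/witt_zero ?/witt_one /=;
have [N [g [x [y [z [-> -> _]]]]]] := witt_lift (wcoord a) (wcoord b) (wcoord a);
rewrite -?(@wmap0 _ _ _ g) -?(@wmap1 _ _ _ g) -?(wmapN, wmapD, wmapM);
apply: (congr1 (wmap g)); apply: (wghost_inj p_pr) => n nR;
rewrite !(wghostN, wghostD, wghostM, wghost0, wghost1) //.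
exact: mulrC. Qed.
Fact witt_mul1 : left_id witt_one witt_mul.
Proof. move=> a; apply: val_inj; rewrite /= ?/witt_zero ?/witt_one /=;
have [N [g [x [y [z [-> _ _]]]]]] := witt_lift (wcoord a) (wcoord a) (wcoord a);
rewrite -?(@wmap0 _ _ _ g) -?(@wmap1 _ _ _ g) -?(wmapN, wmapD, wmapM);
apply: (congr1 (wmap g)); apply: (wghost_inj p_pr) => n nR;
rewrite !(wghostN, wghostD, wghostM, wghost0, wghost1) //.
exact: mul1r. Qed.
Fact witt_mulD : left_distributive witt_mul +%R.
Proof. move=> a b c; apply: val_inj; rewrite /= ?/witt_zero ?/witt_one /=;
have [N [g [x [y [z [-> -> ->]]]]]] := witt_lift (wcoord a) (wcoord b) (wcoord c);
rewrite -?(@wmap0 _ _ _ g) -?(@wmap1 _ _ _ g) -?(wmapN, wmapD, wmapM);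
apply: (congr1 (wmap g)); apply: (wghost_inj p_pr) => n nR;
rewrite !(wghostN, wghostD, wghostM, wghost0, wghost1) //.
exact: mulrDl. Qed.
Fact witt_one_neq0 : witt_one != 0.
Proof.
apply/eqP => /(congr1 (fun a : W A => wcoord a ord0)) /eqP.
by rewrite !ffunE oner_eq0.
Qed.
HB.instance Definition _ := GRing.Zmodule_isComNzRing.Build (W A)
  witt_mulA witt_mulC witt_mul1 witt_mulD witt_one_neq0.
End WittRing.

HB.instance Definition _ (p : nat) (p_pr : prime p) (r : nat)
  (A : finComNzRingType) := FinRing.isNzRing.Build (witt p_pr r A).

Record group_alg (F : Type) (gT : finType) :=
  GroupAlg { galg_coef : {ffun gT -> F} }.

Section GroupAlgebra.
Variables (F : fieldType) (gT : finGroupType).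
Local Notation FG := (group_alg F gT).

HB.instance Definition _ := [isNew for @galg_coef F gT].
HB.instance Definition _ := [Choice of FG by <:].

Implicit Types a b c : FG.

Definition galg_zero : FG := GroupAlg 0.
Definition galg_opp a : FG := GroupAlg (- galg_coef a).
Definition galg_add a b : FG := GroupAlg (galg_coef a + galg_coef b).
Definition galg_scale (k : F) a : FG := GroupAlg [ffun g => k * galg_coef a g].

(* Convolution; the basis element of g is the indicator function of g. *)
Definition galg_one : FG := GroupAlg [ffun g => (g == 1%g)%:R].
Definition galg_mul a b : FG :=
  GroupAlg [ffun g => \sum_h galg_coef a h * galg_coef b (h^-1 * g)%g].

Fact galg_addA : associative galg_add.
Proof. by move=> a b c; congr GroupAlg; rewrite /= addrA. Qed.
Fact galg_addC : commutative galg_add.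
Proof. by move=> a b; congr GroupAlg; rewrite /= addrC. Qed.
Fact galg_add0 : left_id galg_zero galg_add.
Proof. by case=> a; congr GroupAlg; rewrite /= add0r. Qed.
Fact galg_addN : left_inverse galg_zero galg_opp galg_add.
Proof. by move=> a; congr GroupAlg; rewrite /= addNr. Qed.
HB.instance Definition _ :=
  GRing.isZmodule.Build FG galg_addA galg_addC galg_add0 galg_addN.

Fact galg_scaleA k l a : galg_scale k (galg_scale l a) = galg_scale (k * l) a.
Proof. by congr GroupAlg; apply/ffunP => g; rewrite !ffunE mulrA. Qed.
Fact galg_scale1 : left_id 1 galg_scale.
Proof. by case=> a; congr GroupAlg; apply/ffunP => g; rewrite !ffunE mul1r. Qed.
Fact galg_scaleDr : right_distributive galg_scale +%R.
Proof. by move=> k a b; congr GroupAlg; apply/ffunP => g; rewrite !ffunE mulrDr. Qed.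
Fact galg_scaleDl a : {morph galg_scale^~ a : k l / k + l}.
Proof. by move=> k l; congr GroupAlg; apply/ffunP => g; rewrite !ffunE mulrDl. Qed.
HB.instance Definition _ := GRing.Zmodule_isLmodule.Build F FG
  galg_scaleA galg_scale1 galg_scaleDr galg_scaleDl.

Fact galg_mulA : associative galg_mul.
Proof.
move=> a b c; congr GroupAlg; apply/ffunP => g; rewrite !ffunE /=.
under eq_bigr do rewrite ffunE mulr_sumr.
under [RHS]eq_bigr do rewrite ffunE mulr_suml.
rewrite [RHS]exchange_big /=; apply: eq_bigr => h _.
rewrite [RHS](reindex_inj (mulgI h)) /=; apply: eq_bigr => k _.
by rewrite mulKg invMg !mulgA mulrA.
Qed.
Fact galg_mul1l : left_id galg_one galg_mul.
Proof.
case=> a; congr GroupAlg; apply/ffunP => g; rewrite !ffunE /=.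
rewrite (bigD1 1%g) //= ffunE eqxx mul1r invg1 mul1g big1 ?addr0 // => h h1.
by rewrite ffunE (negPf h1) mul0r.
Qed.
Fact galg_mul1r : right_id galg_one galg_mul.
Proof.
case=> a; congr GroupAlg; apply/ffunP => g; rewrite !ffunE /=.
rewrite (bigD1 g) //= ffunE mulVg eqxx mulr1 big1 ?addr0 // => h hg.
by rewrite ffunE -eq_mulVg1 (negPf hg) mulr0.
Qed.
Fact galg_mulDl : left_distributive galg_mul +%R.
Proof.
move=> a b c; congr GroupAlg; apply/ffunP => g; rewrite !ffunE -big_split /=.
by apply: eq_bigr => h _; rewrite ffunE mulrDl.
Qed.
Fact galg_mulDr : right_distributive galg_mul +%R.
Proof.
move=> a b c; congr GroupAlg; apply/ffunP => g; rewrite !ffunE -big_split /=.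
by apply: eq_bigr => h _; rewrite ffunE mulrDr.
Qed.
Fact galg_one_neq0 : galg_one != 0.
Proof.
apply/eqP => /(congr1 (fun a => galg_coef a 1%g)) /eqP.
by rewrite !ffunE eqxx oner_eq0.
Qed.
HB.instance Definition _ := GRing.Zmodule_isNzRing.Build FG
  galg_mulA galg_mul1l galg_mul1r galg_mulDl galg_mulDr galg_one_neq0.

Fact galg_scaleAl k a b : k *: (a * b) = k *: a * b.
Proof.
congr GroupAlg; apply/ffunP => g; rewrite !ffunE /= mulr_sumr.
by apply: eq_bigr => h _; rewrite ffunE mulrA.
Qed.
HB.instance Definition _ := GRing.Lmodule_isLalgebra.Build F FG galg_scaleAl.
Fact galg_scaleAr k a b : k *: (a * b) = a * (k *: b).
Proof.
congr GroupAlg; apply/ffunP => g; rewrite !ffunE /= mulr_sumr.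
by apply: eq_bigr => h _; rewrite ffunE mulrCA.
Qed.
HB.instance Definition _ := GRing.Lalgebra_isAlgebra.Build F FG galg_scaleAr.
End GroupAlgebra.

Section SpecialLinear.
Variables (n : nat) (R : finComUnitRingType).
Definition SLgroup : {set {'GL_n[R]}} := [set g | \det (GLval g) == 1].
Fact SL_group_set : group_set SLgroup.
Proof.
apply/group_setP; split=> [|g h]; first by rewrite inE GL_1E det1.
by rewrite !inE GL_ME det_mulmx => /eqP-> /eqP->; rewrite mulr1.
Qed.
Canonical SLgroup_group := Group SL_group_set.
End SpecialLinear.

Definition group_algebra (F : fieldType) (gT : finGroupType) (H : {group gT}) :
  algType F := group_alg F (subg_of H).

Variant linear_group := GL | SL.

Definition points (G : linear_group) (n : nat) (R : finComUnitRingType) :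
    {group {'GL_n[R]}} :=
  match G with GL => 'GL_n[R]%G | SL => SLgroup_group n R end.

(* A field is perfect when it has characteristic 0, or characteristic p and every
   element is a p-th power. *)
Definition perfect (F : fieldType) : Prop :=
  forall p : nat, p \in [pchar F] -> forall x : F, exists y, x = y ^+ p.

(* B-A-bimodules over the field F: a left B-module with a commuting right action
   rscale of A, on which the two induced actions of F agree. *)
HB.mixin Record Lmodule_isBimodule (F : fieldType) (B A : algType F) M
    of GRing.Lmodule B M := {
  rscale : M -> A -> M;
  rscaleDl : forall a, {morph rscale^~ a : x y / x + y};
  rscaleDr : forall x, {morph rscale x : a b / a + b};
  rscale1 : forall x, rscale x 1 = x;
  rscaleM : forall x a b, rscale x (a * b) = rscale (rscale x a) b;
  rscale_lscale : forall (b : B) x a, rscale (b *: x) a = b *: rscale x a;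
  rscale_alg : forall (k : F) x, rscale x k%:A = (k%:A : B) *: x
}.

#[short(type="bimodType")]
HB.structure Definition Bimodule (F : fieldType) (B A : algType F) :=
  { M of GRing.Lmodule B M & Lmodule_isBimodule F B A M }.

Section RegularBimodule.
Variables (F : fieldType) (A : algType F).
Definition regular_rscale (x : A^o) (a : A) : A^o := (x : A) * a.
Fact regular_rscaleDl a : {morph regular_rscale^~ a : x y / x + y}.
Proof. by move=> x y; exact: (mulrDl (x : A)). Qed.
Fact regular_rscaleDr x : {morph regular_rscale x : a b / a + b}.
Proof. by move=> a b; exact: (mulrDr (x : A)). Qed.
Fact regular_rscale1 x : regular_rscale x 1 = x.
Proof. exact: (mulr1 (x : A)). Qed.
Fact regular_rscaleM x a b :
  regular_rscale x (a * b) = regular_rscale (regular_rscale x a) b.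
Proof. exact: (mulrA (x : A)). Qed.
Fact regular_rscale_lscale (b : A) (x : A^o) a :
  regular_rscale (b *: x) a = b *: regular_rscale x a.
Proof. exact: (esym (mulrA b (x : A) a)). Qed.
Fact regular_rscale_alg (k : F) x : regular_rscale x k%:A = (k%:A : A) *: x.
Proof.
by rewrite /regular_rscale -scalerAr mulr1 -[RHS]/(k%:A * (x : A)) -scalerAl mul1r.
Qed.
HB.instance Definition _ := Lmodule_isBimodule.Build F A A A^o
  regular_rscaleDl regular_rscaleDr regular_rscale1 regular_rscaleM regular_rscale_lscale
  regular_rscale_alg.
End RegularBimodule.

Section SumBimodule.
Variables (F : fieldType) (B A : algType F) (M N : bimodType B A).
Definition pair_rscale (x : M * N) (a : A) : M * N := (rscale x.1 a, rscale x.2 a).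
Fact pair_rscaleDl a : {morph pair_rscale^~ a : x y / x + y}.
Proof. by move=> x y; congr pair; apply: rscaleDl. Qed.
Fact pair_rscaleDr x : {morph pair_rscale x : a b / a + b}.
Proof. by move=> a b; congr pair; apply: rscaleDr. Qed.
Fact pair_rscale1 x : pair_rscale x 1 = x.
Proof. by case: x => x y; congr pair; apply: rscale1. Qed.
Fact pair_rscaleM x a b : pair_rscale x (a * b) = pair_rscale (pair_rscale x a) b.
Proof. by congr pair; apply: rscaleM. Qed.
Fact pair_rscale_lscale (b : B) (x : M * N) a : pair_rscale (b *: x) a = b *: pair_rscale x a.
Proof. by congr pair; apply: rscale_lscale. Qed.
Fact pair_rscale_alg (k : F) x : pair_rscale x k%:A = (k%:A : B) *: x.
Proof. by case: x => x y; congr pair; apply: rscale_alg. Qed.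
HB.instance Definition _ := Lmodule_isBimodule.Build F B A (M * N)%type
  pair_rscaleDl pair_rscaleDr pair_rscale1 pair_rscaleM pair_rscale_lscale pair_rscale_alg.
End SumBimodule.

(* The underlying A^op-module of a B-A-bimodule; A^c is the opposite ring. *)
Definition right_module (F : fieldType) (B A : algType F) (M : bimodType B A) :
  Type := M.

Section RightModule.
Variables (F : fieldType) (B A : algType F) (M : bimodType B A).
HB.instance Definition _ := GRing.Zmodule.on (right_module M).
Definition right_scale (a : A^c) (x : right_module M) : right_module M :=
  rscale (x : M) (a : A).
Fact right_scaleA a b x : right_scale a (right_scale b x) = right_scale (a * b) x.
Proof. exact: (esym (rscaleM (x : M) (b : A) (a : A))). Qed.
Fact right_scale1 : left_id 1 right_scale.
Proof. by move=> x; apply: (rscale1 (x : M)). Qed.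
Fact right_scaleDr : right_distributive right_scale +%R.
Proof. by move=> a x y; apply: (rscaleDl (a : A) (x : M)). Qed.
Fact right_scaleDl x : {morph right_scale^~ x : a b / a + b}.
Proof. by move=> a b; apply: (rscaleDr (x : M) (a : A)). Qed.
HB.instance Definition _ := GRing.Zmodule_isLmodule.Build A^c (right_module M)
  right_scaleA right_scale1 right_scaleDr right_scaleDl.
End RightModule.

Definition projective (R : nzRingType) (P : lmodType R) : Prop :=
  forall (X Y : lmodType R) (f : {linear X -> Y}) (g : {linear P -> Y}),
    (forall y, exists x, f x = y) ->
  exists h : {linear P -> X}, forall u, f (h u) = g u.

Section Bimodules.
Variables (F : fieldType) (B A : algType F).

Definition bimod_morphism (X Y : bimodType B A) (f : X -> Y) : Prop :=
  linear f /\ forall x a, f (rscale x a) = rscale (f x) a.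

Definition bimod_projective (P : bimodType B A) : Prop :=
  forall (X Y : bimodType B A) (f : X -> Y) (g : P -> Y),
    bimod_morphism f -> bimod_morphism g -> (forall y, exists x, f x = y) ->
  exists2 h : P -> X, bimod_morphism h & forall u, f (h u) = g u.

Definition bimod_fingen (P : bimodType B A) : Prop :=
  exists (m : nat) (e : 'I_m -> P), forall x : P,
  exists (k : nat) (i : 'I_k -> 'I_m) (b : 'I_k -> B) (a : 'I_k -> A),
    x = \sum_(j < k) rscale (b j *: e (i j)) (a j).
End Bimodules.

Definition balanced (F : fieldType) (C A B : algType F)
    (M : bimodType C A) (N : bimodType A B) (V : zmodType) (t : M -> N -> V) :=
  [/\ forall y, {morph t^~ y : x x' / x + x'},
      forall x, {morph t x : y y' / y + y'}
    & forall x (a : A) y, t (rscale x a) y = t x (a *: y)].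

(* The C-B-bimodule T, with the pairing t, is the tensor product of M and N
   over A: t is the universal A-balanced map, and it is compatible with the outer
   actions.  Hence "M (x)_A N is isomorphic to T as a C-B-bimodule" is the
   existence of such a t. *)
Definition is_tensor_product (F : fieldType) (C A B : algType F)
    (M : bimodType C A) (N : bimodType A B) (T : bimodType C B)
    (t : M -> N -> T) : Prop :=
  [/\ balanced t,
      forall (c : C) x y, t (c *: x) y = c *: t x y,
      forall x y (b : B), t x (rscale y b) = rscale (t x y) b
    & forall (V : zmodType) (s : M -> N -> V), balanced s ->
      (exists h : {additive T -> V}, forall x y, h (t x y) = s x y) /\
      (forall h h' : {additive T -> V},
         (forall x y, h (t x y) = h' (t x y)) -> h =1 h')].

Definition tensor_iso (F : fieldType) (C A B : algType F)
    (M : bimodType C A) (N : bimodType A B) (T : bimodType C B) : Prop :=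
  exists t : M -> N -> T, is_tensor_product t.

Definition induces_stable_equivalence (F : fieldType) (A B : algType F)
    (M : bimodType B A) (N : bimodType A B) : Prop :=
  [/\ projective (M : lmodType B) /\ projective (right_module M : lmodType A^c),
      projective (right_module N : lmodType B^c) /\ projective (N : lmodType A),
      exists Q : bimodType B B,
        [/\ bimod_fingen Q, bimod_projective Q
          & tensor_iso M N (B^o * Q : bimodType B B)%type]
    & exists P : bimodType A A,
        [/\ bimod_fingen P, bimod_projective P
          & tensor_iso N M (A^o * P : bimodType A A)%type]].

Definition stably_equivalent_of_Morita_type (F : fieldType) (A B : algType F) :
    Prop :=
  exists (M : bimodType B A) (N : bimodType A B),
    induces_stable_equivalence M N.

(* In these degenerate cases the two groups are isomorphic:
   - SL_1 is trivial;
   - for r = 2, both unit groups GL_1 are isomorphic to F_q^* x (F_q, +);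
   - W_r(F_2) = Z/2^r, and (Z/16)^* and (F_2[t]/t^4)^* are isomorphic to
     Z/2 x Z/4, while (Z/32)^* and (F_2[t]/t^5)^* are isomorphic to Z/2 x Z/8. *)
Definition rank_one_exception (G : linear_group) (n r q : nat) : bool :=
  (n == 1)%N &&
  [|| (if G is SL then true else false), (r == 2)%N
    | (q == 2)%N && ((r == 4)%N || (r == 5)%N)].

(* Main.v *)
Require Import Defs.
From HB Require Import structures.
From mathcomp Require Import all_boot all_fingroup all_algebra.
From mathcomp Require Import all_solvable qfpoly zify.
From mathcomp.multinomials Require Import mpoly.
From mathcomp.classical Require boolp.
Set Implicit Arguments.
Unset Strict Implicit.
Unset Printing Implicit Defensive.
Import GRing.Theory.
Local Open Scope ring_scope.

(** The two group algebras are told apart by the [p]-exponents of the groups, that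
    is, by the least [m] such that every [p ^ m]-th power is [p]-regular: a stable
    equivalence of Morita type in characteristic [p] preserves it
    ([stable_Morita_pexponent]), and it is larger on the Witt vector side.

    Invariance.  Let [A = F[G]], [B = F[H]], and let [M], [N] be bimodules with
    [M (x)_A N = B (+) Q] and [N (x)_B M = A (+) P].  Each of [M] and [N] is finitely
    generated and projective on the right ([tensor_right_fingen]), so left
    multiplications on it have a trace, well defined up to commutators
    ([dual_trace_indep]).  Thus [N] and [M] induce maps
    [A / [A, A] -> B / [B, B] -> A / [A, A]], whose composite is the trace on
    [N (x)_B M = A (+) P], i.e. the identity plus the trace on [P].  The latter
    vanishes at every [p]-element [v != 1] of [G] ([projective_trace_eq0]).
    Moreover raising to the power [p ^ m] is additive up to commutators
    ([tracial_expr_sum]), also in matrix rings, so the two maps send spans of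
    [p ^ m]-th powers of group elements to spans of such powers
    ([dual_trace_expr_eq0]).  Now suppose that all [h ^+ (p ^ m)] in [H] are
    [p]-regular but that [v = u ^+ (p ^ m) != 1] for some [p]-element [u] of [G].  The
    image of [v] in [B / [B, B]] is a combination of elements [h ^+ (p ^ m)].  These
    are [p]-regular, hence [p ^ N]-th powers for every [N], so that the image of [v]
    back in [A / [A, A]], which is the class of [v], is a combination of elements
    [g ^+ (p ^ N)].  For [N] large these are [p]-regular, and none is conjugate to
    [v]: the coefficient of the class of [v] would be both [1] and [0].

    The exponents.  A [p]-element of the linear group over [F_q[t]/t^r] is [1 + x]
    with [x] nilpotent, so that [x ^+ (n * r) = 0], and [p ^ m >= n * r] kills it
    ([qpoly_pexponent]).  Over Witt vectors [p ^ (r - 1) != 0] because the coordinate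
    of index [j] of [p ^ j z] is [z_0 ^ (p ^ j)] ([wcoord_mulrn_exp]); for [n >= 2] a
    transvection has order greater than [p ^ (r - 1)], and [p ^ (r - 1) >= n * r] in
    the three ranges of the theorem.  For [n = 1] the units [1 + p y] (or [1 + 4], when
    the residue field has two elements) do the same with a slightly smaller
    power of [p] ([witt_GL1_pelt]). *)

(** * Powers and trace functionals *)

(** A nontrivial orbit has size divisible by [p] and [c] is constant on it, so its
    contribution vanishes. *)
Lemma sum_perm_fixed (p m : nat) (p_pr : prime p) (T : finType) (s : {perm T})
    (V : zmodType) (pV : forall v : V, v *+ p = 0) (c : T -> V) :
    (s ^+ (p ^ m) = 1)%g -> (forall x, c (s x) = c x) ->
  \sum_x c x = \sum_(x | s x == x) c x.
Proof.
move=> s_ord cs; rewrite (bigID (fun x => s x == x)) /= -[RHS]addr0; congr (_ + _).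
rewrite (partition_big (porbit s)
  [pred O | O \in porbit s @: [pred x | s x != x]]) /=; last first.
  by move=> x nfix; apply/imsetP; exists x.
apply: big1 => O /imsetP[x0 nfix ->].
have cO y : y \in porbit s x0 -> c y = c x0.
  case/porbitP=> i ->; elim: i => [|i IH]; first by rewrite expg0 perm1.
  by rewrite expgSr permM cs.
have memO x : (s x != x) && (porbit s x == porbit s x0) = (x \in porbit s x0).
  rewrite eq_porbit_mem; apply: andb_idl => /porbitP[i ->].
  apply: contraNneq nfix => /eqP; rewrite -permM -expgSr expgS permM.
  by rewrite (inj_eq perm_inj).
rewrite (eq_bigl _ _ memO) (eq_bigr _ cO) sumr_const.
have dvdO : (#|porbit s x0| %| p ^ m)%N.
  rewrite porbit.unlock (dvdn_trans (dvdn_orbit 'P%act <[s]>%G x0)) //.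
  by rewrite order_dvdn s_ord.
have /(dvdn_pfactor _ _ p_pr)[[|j] _ eO] := dvdO; last first.
  by rewrite eO expnS mulrnA pV mul0rn.
case/negP: nfix; have := iter_porbit s x0.
by rewrite eO /= => ->.
Qed.

(** Expand into words of length [p ^ m]. A nonconstant word has a number of rotations
    divisible by [p], and a tracial map takes one value on all of them; the constant
    words are all that survives. *)
Lemma tracial_expr_sum (p m : nat) (p_pr : prime p) (R : pzRingType)
    (V : zmodType) (pV : forall v : V, v *+ p = 0) (lam : {additive R -> V})
    (lamC : forall x y, lam (x * y) = lam (y * x))
    (I : finType) (x : I -> R) :
  lam ((\sum_i x i) ^+ (p ^ m)) = \sum_i lam (x i ^+ (p ^ m)).
Proof.
have : (0 < p ^ m)%N by rewrite expn_gt0 prime_gt0.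
case En : (p ^ m)%N => [//|n] _.
rewrite -[in LHS](card_ord n.+1) -prodr_const bigA_distr_bigA /= raddf_sum.
pose rot (f : {ffun 'I_n.+1 -> I}) := [ffun i => f (ordS i)].
have rot_inj : injective rot.
  move=> f g /ffunP e; apply/ffunP=> i; have := e (ord_pred i).
  by rewrite !ffunE ord_predK.
pose s := perm rot_inj.
have sXE k f i : (s ^+ k)%g f i = f (iter k (@ordS n.+1) i).
  elim: k f i => [|k IH] f i; first by rewrite expg0 perm1.
  by rewrite expgSr permM permE ffunE IH -iterSr.
have ordSX k (i : 'I_n.+1) : iter k (@ordS n.+1) i = ((i + k) %% n.+1)%N :> nat.
  elim: k => [|k IH] /=; first by rewrite addn0 modn_small.
  by rewrite IH -[(_ %% _).+1%N]addn1 modnDml addn1 addnS.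
have s_ord : (s ^+ (p ^ m) = 1)%g.
  apply/permP => f; apply/ffunP => i; rewrite sXE perm1; congr (f _).
  by apply: val_inj; rewrite /= ordSX En modnDr modn_small.
rewrite (sum_perm_fixed p_pr pV s_ord); last first.
  move=> f; rewrite permE big_ord_recr big_ord_recl lamC /=; congr (lam (_ * _)).
    by rewrite ffunE; congr (x (f _)); apply: val_inj; rewrite /= modnn.
  apply: eq_bigr => i _; rewrite ffunE; congr (x (f _)); apply: val_inj => /=.
  by rewrite modn_small ?ltnS.
rewrite (reindex_onto (fun i : I => [ffun=> i]) (fun f => f ord0)) /=.
  apply: eq_big => [i|i _]; last first.
    rewrite (eq_bigr (fun=> x i)) ?prodr_const ?card_ord // => j _.
    by rewrite ffunE.
  by rewrite ffunE eqxx andbT permE; apply/eqP/ffunP => j; rewrite !ffunE.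
move=> f /eqP fix_f; have fS i : f (ordS i) = f i.
  by rewrite -[in RHS]fix_f permE ffunE.
apply/ffunP => i; rewrite ffunE; have -> : i = iter i (@ordS n.+1) ord0.
  by apply: val_inj; rewrite /= ordSX add0n modn_small.
by elim: (i : nat) => //= k ->.
Qed.

Lemma mxtrace_mulC_tracial (A : pzRingType) (V : zmodType) (lam : {additive A -> V})
    (lamC : forall x y, lam (x * y) = lam (y * x)) k (X Y : 'M[A]_k) :
  lam (\tr (X *m Y)) = lam (\tr (Y *m X)).
Proof.
rewrite /mxtrace !raddf_sum.
under eq_bigr do rewrite mxE raddf_sum.
under [RHS]eq_bigr do rewrite mxE raddf_sum.
rewrite exchange_big; apply: eq_bigr => i _; apply: eq_bigr => j _.
by rewrite lamC.
Qed.

(** Writing a matrix as the sum of its one-entry parts, only the diagonal parts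
    have a power with nonzero trace. *)
Lemma tracial_mxtrace_expr (p m : nat) (p_pr : prime p) (A : nzRingType)
    (V : zmodType) (pV : forall v : V, v *+ p = 0) (lam : {additive A -> V})
    (lamC : forall x y, lam (x * y) = lam (y * x)) k (X : 'M[A]_k) :
  lam (\tr (X ^+ (p ^ m))) = \sum_i lam (X i i ^+ (p ^ m)).
Proof.
pose lamtr : {additive 'M[A]_k -> V} := lam \o @mxtrace A k.
pose E (ij : 'I_k * 'I_k) : 'M[A]_k := \matrix_(a, b)
  (if (a == ij.1) && (b == ij.2) then X ij.1 ij.2 else 0).
have eX : X = \sum_ij E ij.
  apply/matrixP => a b; rewrite summxE (bigD1 (a, b)) //= mxE !eqxx /=.
  rewrite big1 ?addr0 // => -[i j] /= ne; rewrite mxE /=.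
  by case: ifP => // /andP[/eqP ea /eqP eb]; rewrite ea eb eqxx in ne.
rewrite {1}eX -[LHS]/(lamtr _) (tracial_expr_sum _ p_pr pV); last first.
  by move=> Y Z; exact: mxtrace_mulC_tracial.
have Eexp (ij : 'I_k * 'I_k) n : E ij ^+ n.+1 = \matrix_(a, b)
    (if [&& a == ij.1, b == ij.2 & (n == 0)%N || (ij.1 == ij.2)]
     then X ij.1 ij.2 ^+ n.+1 else 0).
  elim: n => [|n IH]; first by apply/matrixP=> a b; rewrite !mxE andbT.
  rewrite exprS IH; apply/matrixP => a b; rewrite !mxE (bigD1 ij.2) //=.
  rewrite big1 ?addr0 => [|c /negPf ne]; last by rewrite [E ij a c]mxE ne andbF mul0r.
  rewrite [E ij _ _]mxE mxE eqxx andbT (eq_sym ij.2); have [ea|] := eqVneq a;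
    last by rewrite mul0r.
  have [eij|ne] := eqVneq ij.1; last by rewrite !andbF mulr0.
  by rewrite !orbT !andbT; case: eqP; rewrite ?mulr0 -?exprS.
have : (0 < p ^ m)%N by rewrite expn_gt0 prime_gt0.
case: (p ^ m)%N => // n _.
rewrite (eq_bigr (fun i => \sum_j lam ((E (i, j) ^+ n.+1) i i))); last first.
  move=> i _; rewrite (bigD1 i) //= Eexp mxE /= !eqxx orbT.
  rewrite big1 ?addr0 // => j /negPf ne.
  by rewrite Eexp mxE /= eqxx /= eq_sym ne raddf0.
rewrite pair_big; apply: eq_bigr => -[i j] _ /=; rewrite /lamtr /= /mxtrace.
rewrite raddf_sum (bigD1 i) //= big1 ?addr0 // => a /negPf ne.
by rewrite Eexp mxE /= ne raddf0.
Qed.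

(** * Trace functionals on a group algebra *)

Section GroupAlgebraBasis.
Variables (F : fieldType) (gT : finGroupType).
Local Notation FG := (group_alg F gT).

Definition galg_elt (g : gT) : FG := GroupAlg [ffun h => (h == g)%:R].

Lemma galg_elt_mulE (g : gT) (a : FG) (k : gT) :
  galg_coef (galg_elt g * a) k = galg_coef a (g^-1 * k)%g.
Proof.
rewrite ffunE (bigD1 g) //= ffunE eqxx mul1r big1 ?addr0 // => h /negPf ne.
by rewrite ffunE ne mul0r.
Qed.

Lemma galg_eltM (g h : gT) : galg_elt (g * h) = galg_elt g * galg_elt h.
Proof.
apply/val_inj/ffunP => k; rewrite -[RHS]/(galg_coef _ k) galg_elt_mulE !ffunE.
by rewrite -[in RHS](inj_eq (mulgI g)) mulKVg.
Qed.

Lemma galg_eltX (g : gT) n : galg_elt (g ^+ n) = galg_elt g ^+ n.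
Proof.
elim: n => [|n IH]; first by rewrite expr0; congr GroupAlg.
by rewrite expgS exprS -IH galg_eltM.
Qed.

Lemma galg_sum (a : FG) : a = \sum_g galg_coef a g *: galg_elt g.
Proof.
apply/val_inj/ffunP => k /=.
have coefD : {morph (fun a : FG => galg_coef a k) : x y / x + y >-> x + y}.
  by move=> x y; rewrite ffunE.
have coef0 : galg_coef (0 : FG) k = 0 by rewrite ffunE.
rewrite (big_morph _ coefD coef0).
rewrite (bigD1 k) //= !ffunE eqxx mulr1 big1 ?addr0 // => g.
by rewrite eq_sym => /negPf ne; rewrite !ffunE ne mulr0.
Qed.

(** The trace functionals that separate the conjugacy classes of the group. *)
Definition class_coef (v : gT) (a : FG) : F :=
  \sum_(g in (v ^: [set: gT])%g) galg_coef a g.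

Fact class_coef_linear v : linear_for *%R (class_coef v).
Proof.
move=> c a b; rewrite /class_coef mulr_sumr -big_split; apply: eq_bigr => g _.
by rewrite !ffunE.
Qed.
HB.instance Definition _ v :=
  GRing.isLinear.Build F FG F *%R (class_coef v) (class_coef_linear v).

Lemma class_coefC v (a b : FG) : class_coef v (a * b) = class_coef v (b * a).
Proof.
have E (x y : FG) : class_coef v (x * y) =
    \sum_h \sum_(g | (h * g)%g \in (v ^: [set: gT])%g) galg_coef x h * galg_coef y g.
  rewrite /class_coef; under eq_bigr do rewrite ffunE.
  rewrite exchange_big; apply: eq_bigr => h _ /=.
  rewrite (reindex_inj (mulgI h)) /=.
  by apply: eq_bigr => g _; rewrite mulKg.
rewrite !E (exchange_big_dep predT) //=; apply: eq_bigr => g _.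
apply: eq_big => [h|h _]; last by rewrite mulrC.
by rewrite -(class_transl _ (memJ_class (h * g)%g (in_setT h))) conjgE -mulgA mulKg.
Qed.

Lemma class_coef_elt v g : class_coef v (galg_elt g) = (g \in (v ^: [set: gT])%g)%:R.
Proof.
rewrite /class_coef (eq_bigr (fun h => (h == g)%:R)) => [|h _]; last by rewrite ffunE.
have [gv|gv] := boolP (g \in _).
  by rewrite (bigD1 g) //= eqxx big1 ?addr0 // => h /andP[_ /negPf->].
rewrite big1 // => h hv; case: eqP => // e; by rewrite -e hv in gv.
Qed.
End GroupAlgebraBasis.

(** * Dual bases and traces of bimodules *)

Section RightAction.
Variables (F : fieldType) (B A : algType F) (M : bimodType B A).

Lemma rscale0l (a : A) : rscale (0 : M) a = 0.
Proof. by apply: (addIr (rscale 0 a)); rewrite -rscaleDl !add0r. Qed.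

Lemma rscale0r (x : M) : rscale x (0 : A) = 0.
Proof. by apply: (addIr (rscale x 0)); rewrite -rscaleDr !add0r. Qed.

Lemma rscale_suml (I : finType) (x : I -> M) (a : A) :
  rscale (\sum_i x i) a = \sum_i rscale (x i) a.
Proof. exact: (big_morph (rscale^~ a) (rscaleDl a) (rscale0l a)). Qed.

Lemma rscale_sumr (I : finType) (x : M) (a : I -> A) :
  rscale x (\sum_i a i) = \sum_i rscale x (a i).
Proof. exact: (big_morph (rscale x) (rscaleDr x) (rscale0r x)). Qed.

Lemma rscaleZr (c : F) (x : M) (a : A) :
  rscale x (c *: a) = (c%:A : B) *: rscale x a.
Proof. by rewrite -[a in LHS]mul1r scalerAl rscaleM rscale_alg rscale_lscale. Qed.
End RightAction.

(** A finite dual basis is what the projectivity of a finitely generated right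
    module amounts to; it gives left multiplications a trace. *)
Definition dual_basis (F : fieldType) (B A : algType F) (M : bimodType B A)
    (I : finType) (e : I -> M) (phi : I -> M -> A) : Prop :=
  [/\ forall i, {morph phi i : x y / x + y},
      forall i x a, phi i (rscale x a) = phi i x * a
    & forall x, x = \sum_i rscale (e i) (phi i x)].

Section DualBasis.
Variables (F : fieldType) (B A : algType F) (M : bimodType B A).
Variables (I : finType) (e : I -> M) (phi : I -> M -> A).
Hypothesis phi_basis : dual_basis e phi.

Lemma dual_sum i (J : finType) (x : J -> M) :
  phi i (\sum_j x j) = \sum_j phi i (x j).
Proof.
have [phiD phiM _] := phi_basis; apply: (big_morph (phi i) (phiD i)).
by have := phiM i 0 0; rewrite rscale0l mulr0.
Qed.

Lemma dual_scale_alg i (c : F) (x : M) : phi i ((c%:A : B) *: x) = c *: phi i x.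
Proof.
by have [_ phiM _] := phi_basis; rewrite -rscale_alg phiM -scalerAr mulr1.
Qed.

Variables (V : zmodType) (lam : {additive A -> V}).
Hypothesis lamC : forall x y, lam (x * y) = lam (y * x).

Definition dual_trace (b : B) : V := \sum_i lam (phi i (b *: e i)).

(** Both sides expand to the sum of the [lam (phi i (b *: f j) * psi j (e i))]. *)
Lemma dual_trace_indep (J : finType) (f : J -> M) (psi : J -> M -> A) (b : B) :
    dual_basis f psi ->
  dual_trace b = \sum_j lam (psi j (b *: f j)).
Proof.
move=> psi_basis; have [phiD phiM phiE] := phi_basis.
have [psiD psiM psiE] := psi_basis.
transitivity (\sum_i \sum_j lam (phi i (b *: f j) * psi j (e i))).
  apply: eq_bigr => i _; rewrite [e i in LHS]psiE scaler_sumr dual_sum raddf_sum.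
  by apply: eq_bigr => j _; rewrite -rscale_lscale phiM.
rewrite exchange_big; apply: eq_bigr => j _ /=.
rewrite [b *: f j in RHS]phiE.
have psi0 : psi j 0 = 0 by have := psiM j 0 0; rewrite rscale0l mulr0.
rewrite (big_morph (psi j) (psiD j) psi0) raddf_sum.
by apply: eq_bigr => i _; rewrite psiM lamC.
Qed.

Lemma dual_trace_scale_comp (b b' : B) :
  \sum_i lam (phi i ((b * b') *: e i)) =
  \sum_i \sum_j lam (phi i (b *: e j) * phi j (b' *: e i)).
Proof.
have [_ phiM phiE] := phi_basis; apply: eq_bigr => i _.
rewrite -scalerA [b' *: e i in LHS]phiE scaler_sumr dual_sum raddf_sum.
by apply: eq_bigr => j _; rewrite -rscale_lscale phiM.
Qed.

(** So [dual_trace] is again a tracial functional: this is the transfer map between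
    the quotients by commutators, seen on functionals. *)
Lemma dual_traceC (b b' : B) : dual_trace (b * b') = dual_trace (b' * b).
Proof.
rewrite /dual_trace !dual_trace_scale_comp exchange_big.
by apply: eq_bigr => i _; apply: eq_bigr => j _; rewrite lamC.
Qed.
End DualBasis.

Lemma dual_trace_linear (F : fieldType) (B A : algType F) (M : bimodType B A)
    (I : finType) (e : I -> M) (phi : I -> M -> A) (phi_basis : dual_basis e phi)
    (lam : {scalar A}) : linear_for *%R (dual_trace e phi lam).
Proof.
move=> c x y; have [phiD _ _] := phi_basis.
rewrite /dual_trace mulr_sumr -big_split; apply: eq_bigr => i _ /=.
rewrite scalerDl phiD raddfD -[c *: x]mul1r -scalerAr scalerAl -scalerA.
by rewrite (dual_scale_alg phi_basis) -[c * _]scalarZ.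
Qed.

(** On a group algebra the [p ^ m]-th power is, up to commutators, a semilinear map
    that takes group elements to group elements. *)
Lemma tracial_galg_expr (p m : nat) (F : fieldType) (pcharF : p \in [pchar F])
    (gT : finGroupType) (lam : {scalar group_alg F gT})
    (lamC : forall x y, lam (x * y) = lam (y * x)) (a : group_alg F gT) :
  lam (a ^+ (p ^ m)) =
    \sum_g galg_coef a g ^+ (p ^ m) * lam (galg_elt F (g ^+ (p ^ m))%g).
Proof.
rewrite [a in LHS]galg_sum (tracial_expr_sum _ (pcharf_prime pcharF)) //; last first.
  exact: mulrn_pchar.
by apply: eq_bigr => g _; rewrite exprZn galg_eltX -[RHS]scalarZ.
Qed.

(** Left multiplication by [b] acts through the matrix [X b] in the dual basis, so that
    [b ^+ (p ^ m)] acts through [X b ^+ (p ^ m)], whose trace is a sum of [p ^ m]-th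
    powers of elements of the group algebra. *)
Lemma dual_trace_expr_eq0 (p m : nat) (F : fieldType) (pcharF : p \in [pchar F])
    (gT : finGroupType) (B : algType F) (M : bimodType B (group_alg F gT))
    (I : finType) (e : I -> M) (phi : I -> M -> group_alg F gT)
    (phi_basis : dual_basis e phi) (lam : {scalar group_alg F gT})
    (lamC : forall x y, lam (x * y) = lam (y * x)) (b : B) :
    (forall g, lam (galg_elt F (g ^+ (p ^ m))%g) = 0) ->
  dual_trace e phi lam (b ^+ (p ^ m)) = 0.
Proof.
move=> lam_pow; have p_pr := pcharf_prime pcharF.
have [phiD phiM phiE] := phi_basis.
pose X (b : B) := \matrix_(i < #|I|, j < #|I|) phi (enum_val i) (b *: e (enum_val j)).
have trX y : \tr (X y) = \sum_i phi i (y *: e i).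
  by rewrite big_enum_val; apply: eq_bigr => i _; rewrite mxE.
have XM y z : X (y * z) = X y *m X z.
  apply/matrixP => i k; rewrite !mxE -scalerA [z *: _ in LHS]phiE scaler_sumr.
  rewrite (dual_sum phi_basis) big_enum_val; apply: eq_bigr => j _.
  by rewrite !mxE -rscale_lscale phiM.
have XX n : X (b ^+ n.+1) = X b ^+ n.+1.
  by elim: n => // n IH; rewrite exprS XM IH [RHS]exprS.
have : (0 < p ^ m)%N by rewrite expn_gt0 prime_gt0.
rewrite /dual_trace -raddf_sum -trX.
case En : (p ^ m)%N => [//|n] _; rewrite XX -En (tracial_mxtrace_expr _ p_pr) //.
  apply: big1 => i _; apply: etrans (tracial_galg_expr m pcharF lamC _) _.
  by apply: big1 => g _; rewrite lam_pow mulr0.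
exact: mulrn_pchar.
Qed.

Section ZmodClosedType.
Variables (T : zmodType) (S : {pred T}) (S_closed : zmod_closed S).

(** Carrying the closure proof makes the subgroup structure inferable. *)
Definition closed_pred of zmod_closed S : {pred T} := S.
HB.instance Definition _ :=
  GRing.isZmodClosed.Build T (closed_pred S_closed) S_closed.

Record zmod_closed_type := ZmodClosedType {
  zmod_closed_val :> T; _ : zmod_closed_val \in closed_pred S_closed
}.
HB.instance Definition _ := [isSub for zmod_closed_val].
HB.instance Definition _ := [Choice of zmod_closed_type by <:].
HB.instance Definition _ := [SubChoice_isSubZmodule of zmod_closed_type by <:].
End ZmodClosedType.

Section TensorDualBasis.
Variables (F : fieldType) (C A B : algType F).
Variables (M : bimodType C A) (N : bimodType A B) (T : bimodType C B).
Variables (t : M -> N -> T) (tT : is_tensor_product t).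

Lemma tensor_suml (I : finType) (x : I -> M) (y : N) :
  t (\sum_i x i) y = \sum_i t (x i) y.
Proof.
have [[tD _ _] _ _ _] := tT; apply: (big_morph (t^~ y) (tD y)).
by apply: (addIr (t 0 y)); rewrite -tD !add0r.
Qed.

Lemma tensor_sumr (I : finType) (x : M) (y : I -> N) :
  t x (\sum_i y i) = \sum_i t x (y i).
Proof.
have [[_ tD _] _ _ _] := tT; apply: (big_morph (t x) (tD x)).
by apply: (addIr (t x 0)); rewrite -tD !add0r.
Qed.

Definition tensor_sums (z : T) : Prop :=
  exists (n : nat) (x : 'I_n -> M) (y : 'I_n -> N), z = \sum_i t (x i) (y i).

Fact tensor_sums_closed : zmod_closed [pred z | boolp.asbool (tensor_sums z)].
Proof.
split=> [|z z']; rewrite !unfold_in /=.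
  apply/boolp.asboolP; exists 0%N, (fun=> 0), (fun=> 0); by rewrite big_ord0.
have [[tD _ _] _ _ _] := tT.
move=> /boolp.asboolP[n [x [y ->]]] /boolp.asboolP[n' [x' [y' ->]]].
apply/boolp.asboolP; exists (n + n')%N.
exists (fun i => match split i with inl j => x j | inr j => - x' j end).
exists (fun i => match split i with inl j => y j | inr j => y' j end).
rewrite big_split_ord /= -sumrN; congr (_ + _); apply: eq_bigr => i _.
  by rewrite (unsplitK (inl _)).
rewrite (unsplitK (inr _)); apply: (addIr (t (x' i) (y' i))).
rewrite addNr -tD addNr; apply: (addIr (t 0 (y' i))).
by rewrite -tD !add0r.
Qed.

(** The pairing corestricts to the subgroup of sums of pure tensors, and so does the
    identity, by universality. *)
Lemma tensor_sumsP (z : T) : tensor_sums z.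
Proof.
pose S := zmod_closed_type tensor_sums_closed.
have S_t x y : t x y \in closed_pred tensor_sums_closed.
  apply/boolp.asboolP; exists 1%N, (fun=> x), (fun=> y); by rewrite big_ord1.
pose s x y : S := ZmodClosedType (S_t x y).
have [[tDl tDr tA] _ _ tU] := tT.
have s_bal : balanced s.
  by split=> [y x x'|x y y'|x a y]; apply: val_inj; rewrite /= ?(tDl, tDr, tA).
have [[h hE] _] := tU S s s_bal.
have [_ uniq_T] := tU T t (And3 tDl tDr tA).
have <- : val (h z) = z.
  by apply: (uniq_T (val \o h) idfun) => x y /=; rewrite hE.
exact/boolp.asboolP/(valP (h z)).
Qed.

Variables (I J : finType) (e : I -> M) (phi : I -> M -> A).
Variables (f : J -> N) (psi : J -> N -> B).
Hypotheses (phi_basis : dual_basis e phi) (psi_basis : dual_basis f psi).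

(** With these dual bases the trace on the tensor product is the composite of the two
    transfer maps. *)
Lemma tensor_dual_basis :
  exists2 chi : I * J -> T -> B, dual_basis (fun ij => t (e ij.1) (f ij.2)) chi
  & forall ij x y, chi ij (t x y) = psi ij.2 (phi ij.1 x *: y).
Proof.
have [[tDl tDr tA] _ tB tU] := tT.
have [phiD phiM phiE] := phi_basis; have [psiD psiM psiE] := psi_basis.
have ex ij : exists h : {additive T -> B},
    forall x y, h (t x y) = psi ij.2 (phi ij.1 x *: y).
  apply: (proj1 (tU _ (fun x y => psi ij.2 (phi ij.1 x *: y)) _)); split.
  - by move=> y x x'; rewrite phiD scalerDl psiD.
  - by move=> x y y'; rewrite scalerDr psiD.
  - by move=> x a y; rewrite phiM scalerA.
have [chi chiE] := fin_all_exists ex.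
exists chi => //; split=> [ij|ij z b|z]; first exact: raddfD.
- have [n [x [y ->]]] := tensor_sumsP z.
  rewrite rscale_suml !raddf_sum mulr_suml; apply: eq_bigr => k _.
  by rewrite -tB !chiE -rscale_lscale psiM.
have [n [x [y ->]]] := tensor_sumsP z.
under [RHS]eq_bigr do rewrite raddf_sum rscale_sumr.
rewrite exchange_big; apply: eq_bigr => k _ /=.
under [RHS]eq_bigr do rewrite chiE -tB.
rewrite -(pair_bigA _ (fun i j =>
  t (e i) (rscale (f j) (psi j (phi i (x k) *: y k))))) /=.
rewrite [x k in LHS]phiE tensor_suml; apply: eq_bigr => i _.
by rewrite tA [_ *: y k in LHS]psiE tensor_sumr.
Qed.
End TensorDualBasis.

(** * Finite generation and projectivity on the right *)

(** Split the surjection from the free right module on the generators. *)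
Lemma right_projective_dual_basis (F : fieldType) (B A : algType F)
    (M : bimodType B A) (I : finType) (e : I -> M) :
    (forall x, exists c : I -> A, x = \sum_i rscale (e i) (c i)) ->
    projective (right_module M : lmodType A^c) ->
  exists phi, dual_basis e phi.
Proof.
move=> gen_e /(_ {ffun I -> (A^c)^o} (right_module M)).
pose f (x : {ffun I -> (A^c)^o}) : right_module M := \sum_i rscale (e i) (x i : A).
have f_lin : linear f.
  move=> a x y; rewrite -[a *: f x]/(rscale (f x : M) (a : A)) /f rscale_suml -big_split.
  apply: eq_bigr => i _; rewrite !ffunE rscaleDr; congr (_ + _).
  by rewrite -rscaleM.
pose fL : {linear _ -> _} := HB.pack f (GRing.isLinear.Build _ _ _ _ f f_lin).
case/(_ fL idfun) => [x|h hK].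
  have [c ->] := gen_e x; exists [ffun i => c i].
  by rewrite /= /f; apply: eq_bigr => i _; rewrite ffunE.
exists (fun i x => h x i); split=> [i x y|i x a|x].
- by rewrite raddfD ffunE.
- by have /ffunP/(_ i) := linearZZ h (a : A^c) (x : right_module M); rewrite ffunE.
- by have := hK x; rewrite /= /f => {1}<-.
Qed.

Lemma bimod_fingen_regular_sum (F : fieldType) (B : algType F) (Q : bimodType B B) :
  bimod_fingen Q -> bimod_fingen (B^o * Q : bimodType B B)%type.
Proof.
move=> [m [e gen_e]]; exists m.+1, (fun i => if unlift ord0 i is Some j
  then (0, e j) : (B^o * Q)%type else (1, 0)).
case=> b z; have [k [i [c [d ->]]]] := gen_e z.
exists k.+1, (fun j => if unlift ord0 j is Some l then lift ord0 (i l) else ord0).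
exists (fun j => if unlift ord0 j is Some l then c l else b).
exists (fun j => if unlift ord0 j is Some l then d l else 1).
rewrite big_ord_recl !unlift_none rscale1.
under [in RHS]eq_bigr do rewrite !liftK.
have -> : (b, \sum_(j < k) rscale (c j *: e (i j)) (d j)) =
    (b, 0) + \sum_(j < k) (0, rscale (c j *: e (i j)) (d j)) :> (B^o * Q)%type.
  rewrite [X in _ = _ + X](_ : _ = (0, \sum_(j < k) rscale (c j *: e (i j)) (d j))).
    by congr pair; rewrite ?addr0 ?add0r.
  by elim/big_ind2: _ => // x1 x2 y1 y2 -> ->; congr pair; rewrite addr0.
congr (_ + _).
  by congr pair; [rewrite -[RHS]/(b * 1) mulr1 | rewrite /= scaler0].
apply: eq_bigr => j _; congr pair.
by rewrite /= scaler0 rscale0l.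
Qed.

Section TensorFingen.
Variables (F : fieldType) (A B : algType F).
Variables (K : finType) (beta : K -> B).
Hypothesis beta_span : forall b : B, exists c : K -> F, b = \sum_k c k *: beta k.
Variables (M : bimodType B A) (N : bimodType A B).
Variables (T : bimodType B B) (t : M -> N -> T).
Hypotheses (tT : is_tensor_product t) (T_fingen : bimod_fingen T).
Variables (T' : bimodType A A) (t' : N -> M -> T').
Hypothesis tT' : is_tensor_product t'.
Variables (pi : {linear T' -> A^o}) (z0 : T').
Hypothesis pi_z0 : pi z0 = 1.

(** The products [rscale x (pi (t' y w))] factor through [x (x) y] in [T]. As [T] is
    finitely generated, finitely many [x] suffice to write all of [T], hence all the
    products; and [x = rscale x (pi z0)] is a sum of such products. *)
Lemma tensor_right_fingen :
  exists (I : finType) (e : I -> M),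
    forall x, exists c : I -> A, x = \sum_i rscale (e i) (c i).
Proof.
have [m [g gen_g]] := T_fingen.
have ex_g i := tensor_sumsP tT (g i).
have [n /fin_all_exists[gx /fin_all_exists[gy gE]]] := fin_all_exists ex_g.
pose I : finType := ({i : 'I_m & 'I_(n i)} * K)%type.
pose e (u : I) : M := beta u.2 *: gx (tag u.1) (tagged u.1).
exists I, e; pose G (x : M) := exists c : I -> A, x = \sum_i rscale (e i) (c i).
have GD x y : G x -> G y -> G (x + y).
  move=> [c ->] [d ->]; exists (fun i => c i + d i).
  by rewrite -big_split; apply: eq_bigr => i _; rewrite rscaleDr.
have G0 : G 0 by exists (fun=> 0); rewrite big1 // => i _; rewrite rscale0r.
have Gsum (J : finType) (x : J -> M) : (forall j, G (x j)) -> G (\sum_j x j).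
  by move=> Gx; elim/big_ind: _.
have Gscale x a : G x -> G (rscale x a).
  move=> [c ->]; exists (fun i => c i * a).
  by rewrite rscale_suml; apply: eq_bigr => i _; rewrite rscaleM.
have Ggen b i l : G (b *: gx i l).
  have [c ->] := beta_span b; rewrite scaler_suml; apply: (Gsum) => k.
  rewrite -[c k *: beta k]mul1r -scalerAr scalerAl -scalerA -rscale_alg.
  pose u0 : I := (Tagged (fun i => 'I_(n i) : Type) l, k).
  apply: (Gscale); exists (fun u => if u == u0 then 1 else 0).
  rewrite (bigD1 u0) //= eqxx rscale1 big1 ?addr0 // => u /negPf->.
  exact: rscale0r.
have [[tDl tDr tA] tB _ tU] := tT; have [[tDl' tDr' tA'] tB' _ _] := tT'.
(* Every value of [h] is a sum of products with finitely many left factors. *)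
have Gh (w : M) (h : {additive T -> M}) :
    (forall x y, h (t x y) = rscale x (pi (t' y w))) -> forall z, G (h z).
  move=> hE z; have [k [i [b [a ->]]]] := gen_g z; rewrite raddf_sum.
  apply: (Gsum) => j; rewrite gE scaler_sumr rscale_suml raddf_sum.
  apply: (Gsum) => l; have [_ _ tR _] := tT.
  by rewrite -tB -tR hE; apply: Gscale.
move=> x; rewrite -/(G x) -[x]rscale1 -pi_z0.
have [k [y [w ->]]] := tensor_sumsP tT' z0.
rewrite raddf_sum rscale_sumr; apply: (Gsum) => j.
have [h hE] : exists h : {additive T -> M},
    forall x y, h (t x y) = rscale x (pi (t' y (w j))).
  apply: (proj1 (tU _ (fun x y => rscale x (pi (t' y (w j)))) _)); split.
  - by move=> v u u'; rewrite rscaleDl.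
  - by move=> u v v'; rewrite tDl' raddfD rscaleDr.
  - by move=> u a v; rewrite tB' linearZZ rscaleM.
by rewrite -hE; apply: Gh hE _.
Qed.
End TensorFingen.

(** * The trace on a projective bimodule *)

Section FreeBimodule.
Variables (F : fieldType) (gT : finGroupType) (I : finType).
Local Notation FG := (group_alg F gT).

(** The free [FG]-[FG]-bimodule on [I]: since [FG (x) FG] is a free right module on
    the [g (x) 1], an element is recorded by its right coordinates. *)
Definition free_bimod : Type := {ffun I * gT -> FG}.
HB.instance Definition _ := GRing.Zmodule.on free_bimod.

Definition free_lscale (a : FG) (x : free_bimod) : free_bimod :=
  [ffun ig => \sum_h galg_coef a h *: x (ig.1, h^-1 * ig.2)%g].

Fact free_lscaleA a b x : free_lscale a (free_lscale b x) = free_lscale (a * b) x.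
Proof.
apply/ffunP => -[i g]; rewrite !ffunE /=.
under eq_bigr do rewrite ffunE /= scaler_sumr.
under [RHS]eq_bigr do rewrite ffunE scaler_suml.
rewrite [RHS]exchange_big; apply: eq_bigr => h _ /=.
rewrite [RHS](reindex_inj (mulgI h)); apply: eq_bigr => k _ /=.
by rewrite mulKg invMg mulgA scalerA.
Qed.
Fact free_lscale1 : left_id 1 free_lscale.
Proof.
move=> x; apply/ffunP => -[i g]; rewrite ffunE (bigD1 1%g) //= ffunE eqxx scale1r.
by rewrite invg1 mul1g big1 ?addr0 // => h /negPf ne; rewrite ffunE ne scale0r.
Qed.
Fact free_lscaleDr : right_distributive free_lscale +%R.
Proof.
move=> a x y; apply/ffunP => ig; rewrite !ffunE -big_split.
by apply: eq_bigr => h _; rewrite ffunE scalerDr.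
Qed.
Fact free_lscaleDl x : {morph free_lscale^~ x : a b / a + b}.
Proof.
move=> a b; apply/ffunP => ig; rewrite !ffunE -big_split.
by apply: eq_bigr => h _; rewrite ffunE scalerDl.
Qed.
HB.instance Definition _ := GRing.Zmodule_isLmodule.Build FG free_bimod
  free_lscaleA free_lscale1 free_lscaleDr free_lscaleDl.

Definition free_rscale (x : free_bimod) (a : FG) : free_bimod :=
  [ffun ig => x ig * a].

Fact free_rscaleDl a : {morph free_rscale^~ a : x y / x + y}.
Proof. by move=> x y; apply/ffunP => ig; rewrite !ffunE mulrDl. Qed.
Fact free_rscaleDr x : {morph free_rscale x : a b / a + b}.
Proof. by move=> a b; apply/ffunP => ig; rewrite !ffunE mulrDr. Qed.
Fact free_rscale1 x : free_rscale x 1 = x.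
Proof. by apply/ffunP => ig; rewrite ffunE mulr1. Qed.
Fact free_rscaleM x a b : free_rscale x (a * b) = free_rscale (free_rscale x a) b.
Proof. by apply/ffunP => ig; rewrite !ffunE mulrA. Qed.
Fact free_rscale_lscale (b : FG) (x : free_bimod) a :
  free_rscale (b *: x) a = b *: free_rscale x a.
Proof.
apply/ffunP => ig; rewrite !ffunE mulr_suml.
by apply: eq_bigr => h _; rewrite ffunE scalerAl.
Qed.
Fact free_rscale_alg (c : F) (x : free_bimod) :
  free_rscale x c%:A = (c%:A : FG) *: x.
Proof.
apply/ffunP => -[i g]; rewrite !ffunE (bigD1 1%g) //= !ffunE eqxx mulr1 invg1 mul1g.
rewrite big1 ?addr0 => [|h /negPf ne]; first by rewrite -scalerAr mulr1.
by rewrite !ffunE ne mulr0 scale0r.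
Qed.
HB.instance Definition _ := Lmodule_isBimodule.Build F FG FG free_bimod
  free_rscaleDl free_rscaleDr free_rscale1 free_rscaleM free_rscale_lscale
  free_rscale_alg.

Lemma free_lscale_elt (h : gT) (x : free_bimod) i g :
  (galg_elt F h *: x) (i, g) = x (i, h^-1 * g)%g.
Proof.
rewrite ffunE (bigD1 h) //= ffunE eqxx scale1r big1 ?addr0 // => k /negPf ne.
by rewrite ffunE ne scale0r.
Qed.
End FreeBimodule.

(** The dual basis comes from a section of a free bimodule mapping onto [P]. In it the
    trace of [v] is a sum over the [g] in the group of terms that depend only on the
    conjugate [g^-1 * v^-1 * g], hence are invariant under [g |-> v * g], a permutation
    of [p]-power order without fixed points. *)
Lemma projective_trace_eq0 (p : nat) (F : fieldType) (pcharF : p \in [pchar F])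
    (gT : finGroupType) (P : bimodType (group_alg F gT) (group_alg F gT)) :
    bimod_fingen P -> bimod_projective P ->
  exists (I : finType) (e : I -> P) (phi : I -> P -> group_alg F gT),
    dual_basis e phi /\
    forall v : gT, (p.-elt v)%g -> v != 1%g -> \sum_i phi i (galg_elt F v *: e i) = 0.
Proof.
move=> [m [e gen_e]] projP.
pose X : bimodType (group_alg F gT) (group_alg F gT) := free_bimod F gT 'I_m.
pose f (x : X) : P :=
  \sum_ig rscale (galg_elt F ig.2 *: e ig.1) ((x : free_bimod _ _ _) ig).
have f_mor : bimod_morphism f.
  split=> [a x y|x a]; last first.
    rewrite /f rscale_suml; apply: eq_bigr => ig _.
    by rewrite -rscaleM [rscale x a ig]ffunE.
  rewrite /f; under eq_bigr => ig _ do
    rewrite [(a *: x + y : free_bimod F gT 'I_m) ig]ffunE rscaleDr.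
  rewrite big_split; congr (_ + _) => /=.
  rewrite [a in RHS]galg_sum scaler_suml.
  under [LHS]eq_bigr => ig _ do
    rewrite [(a *: x : free_bimod F gT 'I_m) ig]ffunE rscale_sumr.
  rewrite exchange_big; apply: eq_bigr => h _ /=.
  pose t (ig : 'I_m * gT) := (ig.1, h * ig.2)%g.
  have t_inj : injective t by move=> [i g] [j k] [-> /mulgI->].
  rewrite (reindex_inj t_inj) scaler_sumr; apply: eq_bigr => -[i g] _ /=.
  rewrite mulKg galg_eltM rscaleZr -scalerA rscale_lscale scalerA.
  by rewrite -scalerAl mul1r.
have f_surj y : exists x, f x = y.
  have [k [i [b [a ->]]]] := gen_e y.
  exists [ffun jg => \sum_(l < k | i l == jg.1) galg_coef (b l) jg.2 *: a l].
  rewrite /f; under [LHS]eq_bigr do rewrite ffunE.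
  rewrite -(pair_bigA _ (fun j g => rscale (galg_elt F g *: e j)
    (\sum_(l < k | i l == j) galg_coef (b l) g *: a l))) /=.
  rewrite (partition_big i predT) //=; apply: eq_bigr => j _.
  under eq_bigr do rewrite (big_morph _ (rscaleDr _) (rscale0r _)) /=.
  rewrite exchange_big; apply: eq_bigr => l /eqP-> /=.
  rewrite [b l in RHS]galg_sum scaler_suml rscale_suml; apply: eq_bigr => g _.
  by rewrite rscaleZr -rscale_lscale scalerA -scalerAl mul1r.
have id_mor : bimod_morphism (idfun : P -> P) by split.
have [h [h_lin hR] hK] := projP X P f idfun f_mor id_mor f_surj.
pose hL : {linear _ -> _} := HB.pack h (GRing.isLinear.Build _ _ _ _ h h_lin).
exists ('I_m * gT)%type, (fun ig => galg_elt F ig.2 *: e ig.1).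
exists (fun ig x => (h x : free_bimod _ _ _) ig); split.
  split=> [ig x y|ig x a|x].
  - by rewrite -[h]/(hL : _ -> _) raddfD ffunE.
  - by rewrite hR ffunE.
  - by rewrite -[LHS]hK.
move=> v v_p v1.
rewrite (eq_bigr (fun ig => (h (galg_elt F v *: (galg_elt F ig.2 *: e ig.1)) :
  free_bimod F gT 'I_m) (ig.1, ig.2))); last by case.
rewrite -(pair_bigA _ (fun i g =>
  (h (galg_elt F v *: (galg_elt F g *: e i)) : free_bimod F gT 'I_m) (i, g))) /=.
apply: big1 => i _.
have [N vN] : exists N, #[v]%g = (p ^ N)%N.
  by have /p_natP[N ->] := v_p; exists N.
pose s := perm (mulgI v).
have sN : (s ^+ (p ^ N) = 1)%g.
  apply/permP => g; rewrite perm1 -[RHS]mul1g -(expg_order v) vN.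
  elim: (p ^ N)%N => [|k IH]; first by rewrite !expg0 perm1 mul1g.
  by rewrite expgSr permM IH permE expgS mulgA.
rewrite (sum_perm_fixed (pcharf_prime pcharF) _ sN).
- by apply: big_pred0 => g; rewrite permE -[X in _ == X]mul1g (inj_eq (mulIg g)) (negPf v1).
- by move=> a; rewrite -scaler_nat pcharf0 // scale0r.
move=> g; rewrite permE !scalerA -!galg_eltM.
rewrite -[h]/(hL : _ -> _) !linearZZ !free_lscale_elt !invMg.
by rewrite -!mulgA !mulKg.
Qed.

(** * Invariance of the p-exponent *)

Lemma galg_span (F : fieldType) (gT : finGroupType) (a : group_alg F gT) :
  exists c : gT -> F, a = \sum_g c g *: galg_elt F g.
Proof. by exists (galg_coef a); exact: galg_sum. Qed.

Lemma fst_linear (F : fieldType) (A : algType F) (P : bimodType A A) :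
  linear (fst : (A^o * P : bimodType A A)%type -> A^o).
Proof. by []. Qed.

Definition regular_fst (F : fieldType) (A : algType F) (P : bimodType A A) :
  {linear (A^o * P : bimodType A A)%type -> A^o} :=
  HB.pack (fst : (A^o * P : bimodType A A)%type -> A^o)
    (GRing.isLinear.Build _ _ _ _ _ (fst_linear (P := P))).

Lemma regular_sum_dual_basis (F : fieldType) (A : algType F) (P : bimodType A A)
    (I : finType) (e : I -> P) (phi : I -> P -> A) : dual_basis e phi ->
  dual_basis (fun o => if o is Some i then (0, e i) else (1, 0) : (A^o * P)%type)
    (fun o (z : (A^o * P : bimodType A A)%type) =>
       if o is Some i then phi i z.2 else z.1).
Proof.
case=> phiD phiM phiE; split=> [[i|] x y|[i|] x a|[a x]] //=.
  exact: phiD.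
rewrite (bigD1 None) //= (reindex_omap Some id) //=; last by case.
rewrite [X in _ = _ + X](eq_big predT
  (fun i => (0, rscale (e i) (phi i x)) : (A^o * P)%type)); first last.
- by move=> i _; congr pair; rewrite rscale0l.
- by move=> i; rewrite /= eqxx.
rewrite [X in _ = _ + X](_ : _ = (0, x)).
  by congr pair; rewrite /= ?addr0 ?rscale0l ?add0r // -[RHS]/(1 * a) mul1r.
rewrite {2}[x]phiE.
by elim/big_ind2: _ => // x1 x2 y1 y2 -> ->; congr pair; rewrite addr0.
Qed.

Lemma p'elt_expX (gT : finGroupType) (p N : nat) (g : gT) :
  prime p -> (p^'.-elt g)%g -> exists h : gT, g = (h ^+ (p ^ N))%g.
Proof.
move=> p_pr g_p'; exists (g ^+ expg_invn <[g]> (p ^ N))%g.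
rewrite expgAC expgK ?cycle_id //.
by rewrite coprime_sym coprimeXl // prime_coprime // -p'natE.
Qed.

Lemma p'elt_exp_card (gT : finGroupType) (p : nat) (g : gT) :
  (p^'.-elt (g ^+ (p ^ logn p #|gT|)))%g.
Proof.
rewrite -p_part; have := cardsT gT => eG.
apply: (@pnat_dvd _ (#|gT|`_p^')).
  rewrite order_dvdn -expgM partnC -?eG ?cardG_gt0 // -order_dvdn.
  by apply: (@order_dvdG _ [set: gT]%G); rewrite inE.
exact: part_pnat.
Qed.

(** The class coefficient of [v = u ^+ (p ^ m)], transferred along [N] and [M], is
    computed in two ways: through the decomposition of the tensor product it is [1],
    through powers of group elements it is [0]. *)
Lemma stable_Morita_pexponent (p m : nat) (F : fieldType) (pcharF : p \in [pchar F])
    (gT hT : finGroupType) :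
    stably_equivalent_of_Morita_type (group_alg F gT) (group_alg F hT) ->
    (forall h : hT, (p^'.-elt (h ^+ (p ^ m)))%g) ->
  forall u : gT, (p.-elt u)%g -> (u ^+ (p ^ m))%g = 1%g.
Proof.
move=> [M [N [[_ M_proj] [N_proj _] [Q [Q_fg Q_proj [t tT]]] [P [P_fg P_proj [t' tT']]]]]].
move=> hT_pow u u_p; apply/eqP/negPn/negP => v1.
have p_pr := pcharf_prime pcharF.
set v := (u ^+ (p ^ m))%g in v1.
have v_p : (p.-elt v)%g by apply: mem_p_elt (mem_cycle _ _); exact: u_p.
have [I [e gen_e]] := tensor_right_fingen (@galg_span F gT) tT'
  (bimod_fingen_regular_sum P_fg) tT (pi := regular_fst Q) (z0 := (1, 0)) erefl.
have [J [f gen_f]] := tensor_right_fingen (@galg_span F hT) tT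
  (bimod_fingen_regular_sum Q_fg) tT' (pi := regular_fst P) (z0 := (1, 0)) erefl.
have [psi psi_basis] := right_projective_dual_basis gen_e N_proj.
have [phi phi_basis] := right_projective_dual_basis gen_f M_proj.
have [chi chi_basis chiE] := tensor_dual_basis tT' psi_basis phi_basis.
have [K [g [rho [rho_basis rho0]]]] := projective_trace_eq0 pcharF P_fg P_proj.
pose lam : {scalar group_alg F gT} := class_coef v.
have lamC x y : lam (x * y) = lam (y * x) by exact: class_coefC.
have trT1 : dual_trace (fun ij => t' (e ij.1) (f ij.2)) chi lam (galg_elt F v) = 1.
  rewrite (dual_trace_indep chi_basis lamC _ (regular_sum_dual_basis rho_basis)).
  rewrite (bigD1 None) //= (reindex_omap Some id) //=; last by case.
  rewrite -[X in lam X + _]/(galg_elt F v * 1) mulr1 [lam _]class_coef_elt.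
  rewrite class_refl (eq_bigl predT) => [|k]; last by rewrite /= eqxx.
  rewrite -raddf_sum.
  have -> : \sum_k rho k (galg_elt F v *: g k) = 0 by exact: rho0.
  by rewrite raddf0 addr0.
pose mu b := dual_trace f phi lam b.
have mu_lin : linear_for *%R mu by exact: dual_trace_linear.
pose muL : {scalar group_alg F hT} := HB.pack mu (GRing.isLinear.Build _ _ _ _ _ mu_lin).
have muC x y : muL (x * y) = muL (y * x) by exact: dual_traceC.
have : dual_trace e psi muL (galg_elt F u ^+ (p ^ m)) = 0.
  apply: (dual_trace_expr_eq0 pcharF psi_basis muC) => h.
  have [k ->] := p'elt_expX (logn p #|gT|) p_pr (hT_pow h).
  rewrite galg_eltX; apply: (dual_trace_expr_eq0 pcharF phi_basis lamC) => x.
  rewrite [LHS]class_coef_elt; case: imsetP => // -[y _ xv].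
  have := p'elt_exp_card p x; rewrite xv /p_elt orderJ => v_p'.
  by move: v1; rewrite -order_eq1 (pnat_1 v_p v_p') eqxx.
rewrite -galg_eltX -/v => tr0; have /eqP[] := oner_eq0 F.
have [_ t'B _ _] := tT'.
rewrite -trT1 -[RHS]tr0 [LHS]/dual_trace.
under [LHS]eq_bigr do rewrite -t'B chiE.
by rewrite -(pair_bigA _ (fun i j => lam (phi j (psi i (galg_elt F v *: e i) *: f j)))).
Qed.

(** * Linear groups over truncated polynomials *)

Lemma nilpotent_mx_exp (K : fieldType) (n N : nat) (A : 'M[K]_n.+1) :
  A ^+ N = 0 -> A ^+ n.+1 = 0.
Proof.
move=> AN0; have : mxminpoly A %| ('X - 0%:P) ^+ N.
  by rewrite subr0 dvd_mxminpoly rmorphXn /= horner_mx_X AN0.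
case/dvdp_exp_XsubCP => k _; rewrite subr0 => min_k.
have ltk : (k <= n.+1)%N.
  have := dvdp_leq (monic_neq0 (char_poly_monic A)) (mxminpoly_dvd_char A).
  by rewrite (eqp_size min_k) size_polyXn size_char_poly.
have /eqP : horner_mx A 'X^k == 0 by rewrite -dvd_mxminpoly (eqp_dvdl _ min_k).
have -> : A ^+ n.+1 = A ^+ (n.+1 - k) * A ^+ k by rewrite -exprD subnK.
by rewrite rmorphXn /= horner_mx_X => ->; rewrite mulr0.
Qed.

Section TruncatedPolynomials.
Variables (K : fieldType) (r : nat).
Local Notation S := {poly %/ ('X^r : {poly K})}.

(** Reduction modulo [t]. *)
Definition const_coef (a : S) : K := (a : {poly K}).[0].

Lemma horner0_modXn (a : {poly K}) : (Pdiv.Ring.rmodp a (mk_monic 'X^r)).[0] = a.[0].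
Proof.
rewrite mk_monic_Xn [in RHS](Pdiv.RingMonic.rdivp_eq (monicXn _ r.-1.+1) a).
by rewrite hornerD hornerM hornerXn expr0n mulr0 add0r.
Qed.

Fact const_coef_zmod : zmod_morphism const_coef.
Proof. by move=> a b; rewrite /const_coef poly_of_qpolyD !hornerE. Qed.
Fact const_coef_monoid : monoid_morphism const_coef.
Proof.
split=> [|a b]; first by rewrite /const_coef hornerC.
by rewrite /const_coef poly_of_qpolyM horner0_modXn hornerM.
Qed.
HB.instance Definition _ :=
  GRing.isZmodMorphism.Build S K const_coef const_coef_zmod.
HB.instance Definition _ :=
  GRing.isMonoidMorphism.Build S K const_coef const_coef_monoid.

Lemma const_coef_eq0 (a : S) : const_coef a = 0 ->
  exists b : S, a = in_qpoly 'X^r 'X * b.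
Proof.
move=> a0; have /factor_theorem[b ab] : root (a : {poly K}) 0 by apply/eqP.
exists (in_qpoly _ b); rewrite mulrC -rmorphM /= -[X in _ * X]subr0 -ab.
by apply: val_inj; rewrite /= Pdiv.Ring.rmodp_small // size_mk_monic.
Qed.

Lemma qpolyX_expr0 : (0 < r)%N -> (in_qpoly 'X^r 'X : S) ^+ r = 0.
Proof.
move=> r_gt0; rewrite -rmorphXn; apply: val_inj.
by rewrite /= mk_monic_Xn prednK // Pdiv.RingMonic.rmodpp ?monicXn.
Qed.

(** Modulo [t] a nilpotent matrix has zero [n.+1]-th power, so [X ^+ n.+1] is a
    multiple of [t]. *)
Lemma nilpotent_qpoly_mx (r_gt0 : (0 < r)%N) (n N : nat) (X : 'M[S]_n.+1) :
  X ^+ N = 0 -> X ^+ (n.+1 * r) = 0.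
Proof.
move=> XN0; have X0 : map_mx const_coef (X ^+ n.+1) = 0.
  rewrite rmorphXn; apply: (@nilpotent_mx_exp _ _ N).
  by rewrite -rmorphXn XN0 rmorph0.
have ex i j : exists b : S, (X ^+ n.+1) i j = in_qpoly 'X^r 'X * b.
  by apply: const_coef_eq0; have /matrixP/(_ i j) := X0; rewrite !mxE.
have [b bE] := fin_all_exists (fun i => fin_all_exists (ex i)).
have XE : X ^+ n.+1 = in_qpoly 'X^r 'X *: \matrix_(i, j) b i j.
  by apply/matrixP => i j; rewrite bE !mxE.
by rewrite exprM XE exprZn qpolyX_expr0 // scale0r.
Qed.
End TruncatedPolynomials.

Lemma expr1D_pchar (p : nat) (R : nzRingType) (x : R) (k : nat) :
  p \in [pchar R] -> (1 + x) ^+ (p ^ k) = 1 + x ^+ (p ^ k).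
Proof.
move=> pR; elim: k => [|k IH]; first by rewrite !expr1.
rewrite expnSr !exprM IH -!(pFrobenius_autE pR) pFrobenius_autD_comm.
  by rewrite pFrobenius_aut1.
exact/commr_sym/commr1.
Qed.

(** A [p]-element of the linear group over [K[t]/t^r] is [1 + x] with [x] nilpotent,
    hence [x ^+ (n * r) = 0], and [(1 + x) ^+ (p ^ m) = 1 + x ^+ (p ^ m)]. *)
Lemma qpoly_pexponent (p : nat) (K : finFieldType) (pcharK : p \in [pchar K])
    (n r m : nat) (n_gt0 : (0 < n)%N) (r_gt0 : (0 < r)%N)
    (H : {group {'GL_n[{poly %/ ('X^r : {poly K})}]}}) (h : subg_of H) :
  (n * r <= p ^ m)%N -> (p^'.-elt (h ^+ (p ^ m)))%g.
Proof.
move=> le_nr; have p_pr := pcharf_prime pcharK.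
suff u1 : (h.`_p ^+ (p ^ m) = 1)%g.
  rewrite -[h](consttC p) expgMn; last exact/commuteX2/commute_refl.
  by rewrite u1 mul1g; apply: mem_p_elt (mem_cycle _ _); exact: p_elt_constt.
have /p_natP[k uk] := p_elt_constt p h.
set u := (h.`_p)%g in uk *.
pose U := GLval (sgval u).
have UX i : GLval (sgval (u ^+ i)%g) = U ^+ i.
  by elim: i => // i IH; rewrite expgS exprS -IH.
have pM : p \in [pchar 'M[{poly %/ ('X^r : {poly K})}]_n.-1.+1].
  rewrite inE p_pr /=; apply/eqP; rewrite -(rmorph_nat (@scalar_mx _ _)).
  by rewrite (pcharf0 (R := {poly %/ ('X^r : {poly K})})) ?pchar_qpoly ?rmorph0.
apply/val_inj/val_inj; rewrite [LHS]UX /=.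
have UE : U = 1 + (U - 1) by rewrite addrC subrK.
rewrite UE expr1D_pchar //.
have /(nilpotent_qpoly_mx r_gt0) : (U - 1) ^+ (p ^ k) = 0.
  by apply: (addrI 1); rewrite -expr1D_pchar // -UE -UX -uk expg_order addr0.
have le_n : (n.-1.+1 * r <= p ^ m)%N by rewrite prednK.
by rewrite -(subnK le_n) exprD => ->; rewrite mulr0 addr0.
Qed.

(** * Multiples of powers of p in Witt vectors *)

Lemma add_sqr0_exp (R : nzRingType) (x : R) (k : nat) :
  x * x = 0 -> (1 + x) ^+ k = 1 + x *+ k.
Proof.
move=> xx; elim: k => [|k IH]; first by rewrite mulr0n addr0.
by rewrite exprS IH mulrDl mul1r mulrDr mulr1 mulrnAr xx mul0rn addr0 mulrSr addrA.
Qed.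

Lemma dvdn_pexp_bin (p i l : nat) : prime p -> (0 < i)%N ->
    (2 < p)%N || (1 < i)%N -> (1 < l <= p)%N ->
  (p ^ i.+2 %| p ^ (i * l) * 'C(p, l))%N.
Proof.
move=> p_pr i_gt0 pi /andP[l_gt1]; rewrite leq_eqVlt => /orP[/eqP->|lp].
  rewrite binn muln1 dvdn_exp2l //; have := prime_gt1 p_pr.
  by case/orP: pi => *; nia.
have l_int : (0 < l < p)%N by rewrite lp ltnW.
have /dvdnP[b ->] := prime_dvd_bin p_pr l_int.
rewrite mulnCA dvdn_mull // -expnSr dvdn_exp2l //; nia.
Qed.

(** Multiplication by [p] on [1 + p^k R], [k >= 1], moves the filtration by exactly one
    step; for [p = 2] this starts at [k = 2] only, as [(1 + 2) ^ 2 = 1 + 8]. *)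
Lemma expr1D_pmul (p k j : nat) (p_pr : prime p) (k_gt0 : (0 < k)%N)
    (pk : (2 < p)%N || (1 < k)%N) (R : comNzRingType) (y : R) :
  exists c, (1 + y *+ p ^ k) ^+ (p ^ j) = 1 + (y + c *+ p) *+ p ^ (k + j).
Proof.
have step i (z : R) : (k <= i)%N ->
    exists c, (1 + z *+ p ^ i) ^+ p = 1 + (z + c *+ p) *+ p ^ i.+1.
  move=> ki; have pi : (2 < p)%N || (1 < i)%N.
    by case/orP: pk => [->|/leq_trans->] //; rewrite orbT.
  have i_gt0 : (0 < i)%N by apply: leq_trans ki.
  have [c e] : eqmodn (p ^ i.+2) ((1 + z *+ p ^ i) ^+ p) (1 + z *+ p ^ i.+1).
    have p_gt1 := prime_gt1 p_pr.
    rewrite exprDn -(big_mkord xpredT (fun l =>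
      1 ^+ (p - l) * (z *+ p ^ i) ^+ l *+ 'C(p, l))) 2?big_ltn ?addrA //; last exact: ltnW.
    rewrite -[X in eqmodn _ _ X]addr0; apply: eqmodnD.
      rewrite bin0 bin1 !expr1n !mul1r expr0 expr1 mulr1n -mulrnA -expnSr.
      exact: eqmodn_refl.
    rewrite big_nat_cond; elim/big_ind: _ => [|u v eu ev|l].
    - exact: eqmodn_refl.
    - by rewrite -[0]addr0; exact: eqmodnD.
    rewrite andbT ltnS => /(dvdn_pexp_bin p_pr i_gt0 pi)/dvdnP[d eC].
    rewrite expr1n mul1r exprMn_n -expnM -mulrnA eC.
    by exists (z ^+ l *+ d); rewrite add0r -mulrnA.
  by exists c; rewrite e mulrnDl -mulrnA -expnS addrA.
elim: j => [|j [c IH]].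
  by exists 0; rewrite mul0rn addr0 addn0 expn0 expr1.
have [d e] := step (k + j)%N (y + c *+ p) (leq_addr _ _).
exists (c + d); rewrite expnSr exprM IH e addnS.
by rewrite [(c + d) *+ p]mulrnDl [y + (_ + _)]addrA.
Qed.

Section WittMultiples.
Variables (p : nat) (p_pr : prime p) (r : nat).
Local Notation W := (witt p_pr r).

Lemma wcoord_mulrn_map (A B : comNzRingType) (g : {rmorphism A -> B})
    (x : {ffun 'I_r.-1.+1 -> A}) (n : nat) :
  wcoord ((Witt p_pr (wmap g x) : W B) *+ n) = wmap g (wcoord ((Witt p_pr x : W A) *+ n)).
Proof.
elim: n => [|n IH]; first by rewrite !mulr0n /= wmap0.
by rewrite !mulrS -[LHS]/(witt_add_fun p _ (wcoord _)) IH wmapD.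
Qed.

Lemma wghost_mulrn (A : comNzRingType) (x : W A) (n k : nat) : (k < r.-1.+1)%N ->
  wghost p (wcoord (x *+ n)) k = wghost p (wcoord x) k *+ n.
Proof.
move=> kr; elim: n => [|n IH]; first by rewrite !mulr0n [LHS]wghost0.
by rewrite !mulrS [LHS]wghostD // IH.
Qed.

(** This is the identity [p ^ j = V ^ j F ^ j] of characteristic [p], read off on the
    first nonzero coordinate; it follows from the ghost components of [p ^ j z] over
    a ring of integral polynomials. *)
Lemma wcoord_mulrn_exp (A : comNzRingType) (pA : p \in [pchar A]) (z : W A)
    (j : nat) (jr : (j < r.-1.+1)%N) :
  wcoord (z *+ p ^ j) (Ordinal jr) = wcoord z ord0 ^+ (p ^ j).
Proof.
case: z => z; have [N [g [x [_ [_ [-> _ _]]]]]] := witt_lift z z z.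
rewrite (wcoord_mulrn_map g x) !ffunE /=.
set y := wcoord _; have yE n : (n <= j)%N ->
    eqmodn (p ^ j.+1) (y (inord n) *+ p ^ n) (x (inord 0) ^+ (p ^ n) *+ p ^ j).
  elim/ltn_ind: n => n IH nj.
  have nr : (n < r.-1.+1)%N by apply: leq_ltn_trans jr.
  have := wghost_mulrn (Witt p_pr x) (p ^ j) nr.
  rewrite -/y wghost.unlock ghostS => yS.
  have -> : y (inord n) *+ p ^ n = ghost p (fun i => x (inord i)) n *+ p ^ j -
      \sum_(i < n) y (inord i) ^+ (p ^ (n - i)) *+ p ^ i.
    by rewrite -yS addrAC subrr add0r.
  rewrite -[X in eqmodn _ _ X]subr0; apply: eqmodnD.
    rewrite expnSr; apply: eqmodnMn; rewrite /ghost big_ord_recl subn0 mulr1n.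
    rewrite -[X in eqmodn _ _ X]addr0; apply: eqmodnD; first exact: eqmodn_refl.
    rewrite [X in eqmodn _ _ X](_ : 0 = \sum_(i < n) 0); last by rewrite big1.
    apply: eqmodn_sum => i _; rewrite lift0 expnSr mulrnA.
    by eexists; rewrite add0r.
  (* As [y_i] is a multiple of [p ^ (j - i)] for [i < n], the term [p ^ i y_i ^ (p ^ (n - i))]
     is one of [p ^ (j + 1)]. *)
  apply: eqmodnN; rewrite [X in eqmodn _ _ X](_ : 0 = \sum_(i < n) 0); last first.
    by rewrite big1.
  apply: eqmodn_sum => i _.
  have [c e] := IH i (ltn_ord i) (ltnW (leq_trans (ltn_ord i) nj)).
  have ij : (i < j)%N := leq_trans (ltn_ord i) nj.
  have -> : y (inord i) = (x (inord 0) ^+ (p ^ i) + c *+ p) *+ p ^ (j - i).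
    apply/subr0_eq/(mpoly_tf p_pr (n := i)).
    rewrite mulrnBl e -mulrnA -expnD subnK ?(ltnW ij) // mulrnDl -mulrnA -expnS.
    by rewrite subrr.
  rewrite exprMn_n -mulrnA -expnM -expnD.
  have le_j : (j.+1 <= (j - i) * p ^ (n - i) + i)%N.
    have : (2 <= p ^ (n - i))%N.
      by apply: leq_ltn_trans (ltn_expl _ (prime_gt1 p_pr)); rewrite subn_gt0.
    nia.
  rewrite -(subnK le_j) expnD mulrnA.
  by eexists; rewrite add0r.
have [c e] := yE j (leqnn j).
have -> : Ordinal jr = inord j by apply: val_inj; rewrite /= inordK.
have -> : (ord0 : 'I_r.-1.+1) = inord 0 by apply: val_inj; rewrite /= inordK.
have -> : y (inord j) = x (inord 0) ^+ (p ^ j) + c *+ p.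
  apply/subr0_eq/(mpoly_tf p_pr (n := j)).
  by rewrite mulrnBl e mulrnDl -mulrnA -expnS subrr.
by rewrite rmorphD rmorphXn rmorphMn (mulrn_pchar pA) addr0.
Qed.
End WittMultiples.

(** * p-elements of linear groups over Witt vectors *)

Lemma finComUnitRing_mulrn_card (V : finComUnitRingType) (x : V) : x *+ #|V| = 0.
Proof.
rewrite -FinRing.zmodXgE -cardsT -[RHS]/(1%g : V).
by apply: (expg_cardG (G := [set: V]%G)); rewrite inE.
Qed.

Lemma pchar_of_card (p k : nat) (p_pr : prime p) (K : finFieldType) :
  #|K| = (p ^ k)%N -> p \in [pchar K].
Proof.
move=> cardK; have := finComUnitRing_mulrn_card (1 : K); rewrite cardK natrX => /eqP.
by rewrite expf_eq0 inE p_pr => /andP[].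
Qed.

Section WittFinite.
Variables (p : nat) (p_pr : prime p) (r : nat).

Lemma wcoord0_ghost (A : comNzRingType) (x : witt p_pr r A) :
  wcoord x ord0 = wghost p (wcoord x) 0.
Proof.
rewrite wghost.unlock /ghost big_ord1 mulr1n expr1.
by congr (wcoord x _); apply: val_inj; rewrite /= inordK.
Qed.

Lemma wcoord0D (A : comNzRingType) (x y : witt p_pr r A) :
  wcoord (x + y) ord0 = wcoord x ord0 + wcoord y ord0.
Proof. by rewrite !wcoord0_ghost [LHS]wghostD. Qed.

Lemma wcoord0M (A : comNzRingType) (x y : witt p_pr r A) :
  wcoord (x * y) ord0 = wcoord x ord0 * wcoord y ord0.
Proof. by rewrite !wcoord0_ghost [LHS]wghostM. Qed.

Lemma wcoord0_mulrn (A : comNzRingType) (x : witt p_pr r A) n :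
  wcoord (x *+ n) ord0 = wcoord x ord0 *+ n.
Proof.
by elim: n => [|n IH]; rewrite ?mulr0n ?ffunE // !mulrS wcoord0D IH.
Qed.

Variable K : finFieldType.
Hypothesis pcharK : p \in [pchar K].
Local Notation W := (witt p_pr r K).

Lemma witt_mulrn_neq0 (z : W) (j : nat) :
  (j < r.-1.+1)%N -> wcoord z ord0 != 0 -> z *+ p ^ j != 0.
Proof.
move=> jr z0; apply/eqP => /(congr1 (fun x : W => wcoord x (Ordinal jr))) /eqP.
by rewrite (wcoord_mulrn_exp pcharK) ffunE expf_eq0 (negPf z0) andbF.
Qed.

Lemma card_witt : #|{: W}| = (#|K| ^ r.-1.+1)%N.
Proof.
have f_bij : bijective (fun x : W => wcoord x) by exists (@Witt p p_pr r K) => -[].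
by rewrite (bij_eq_card f_bij) card_ffun card_ord.
Qed.

Lemma witt_mulrn_card k : #|K| = (p ^ k)%N ->
  forall z : W, z *+ p ^ (k * r.-1.+1) = 0.
Proof.
move=> cardK z; rewrite expnM -cardK -card_witt.
exact: (@finComUnitRing_mulrn_card W z).
Qed.
End WittFinite.

Section LinearGroupElements.
Variables (p N m : nat) (p_pr : prime p) (R : finComUnitRingType).

Lemma points_pelt (G : linear_group) (n : nat) (A : 'M[R]_n.-1.+1) :
    A ^+ (p ^ N) = 1 -> A ^+ (p ^ m) != 1 -> (G = SL -> \det A = 1) ->
  exists u : subg_of (points G n R), (p.-elt u)%g /\ (u ^+ (p ^ m) != 1)%g.
Proof.
move=> AN Am detA.
have A_unit : A \is a GRing.unit.
  by rewrite -(@unitrX_pos _ _ (p ^ N)) ?AN ?unitr1 ?expn_gt0 ?prime_gt0.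
pose g : {'GL_n[R]} := Sub A A_unit.
have gG : g \in points G n R.
  by case: G detA => detA; rewrite inE //; apply/eqP/detA.
have sg : sgval (subg (points G n R) g) = g by exact: subgK.
have gX i : GLval (sgval (subg (points G n R) g ^+ i)%g) = A ^+ i.
  elim: i => // i IH; rewrite expgS exprS -IH.
  by rewrite -[LHS]/(GLval (sgval (subg (points G n R) g)) * _) sg.
exists (subg _ g); split; last first.
  by apply: contraNneq Am => e; rewrite -gX e.
apply: (@pnat_dvd _ (p ^ N)); last by rewrite pnatX pnat_id.
by rewrite order_dvdn; apply/eqP/val_inj/val_inj; rewrite [LHS]gX AN.
Qed.

Lemma points_transvection_pelt (G : linear_group) (n : nat) (n_gt1 : (1 < n)%N) :
    (p ^ N)%:R = 0 :> R -> (p ^ m)%:R != 0 :> R ->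
  exists u : subg_of (points G n R), (p.-elt u)%g /\ (u ^+ (p ^ m) != 1)%g.
Proof.
case: n n_gt1 => [|[|n]] // _ pN pm.
pose E : 'M[R]_n.+2 := delta_mx (inord 1) ord0.
have E2 : E * E = 0.
  by rewrite -[LHS]/(E *m E) mul_delta_mx_0 // -val_eqE /= inordK.
apply: (@points_pelt G n.+2 (1 + E)).
- by rewrite [LHS]add_sqr0_exp // -scaler_nat pN scale0r addr0.
- rewrite [X in X != _]add_sqr0_exp // -scaler_nat.
  apply: contraNneq pm => /(congr1 (fun X : 'M[R]_n.+2 => (X - 1) (inord 1) ord0)).
  by rewrite addrC addrA addNr add0r subrr !mxE !eqxx mulr1 => ->.
move=> _; rewrite det_trig ?big1 //.
  by move=> i _; rewrite !mxE eqxx -!val_eqE /= inordK //;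
    case: (i : nat) => [|[|j]]; rewrite ?addr0.
apply/is_trig_mxP => i j ij; rewrite !mxE -!val_eqE /= inordK // (ltn_eqF ij) add0r.
by case: eqP ij => //= ->; case: (j : nat) => [|j'] //; rewrite ?andbF.
Qed.

Lemma points_scalar_pelt (a : R) :
    a ^+ (p ^ N) = 1 -> a ^+ (p ^ m) != 1 ->
  exists u : subg_of (points GL 1 R), (p.-elt u)%g /\ (u ^+ (p ^ m) != 1)%g.
Proof.
move=> aN am; apply: (@points_pelt GL 1 a%:M) => //.
  by rewrite -rmorphXn aN rmorph1.
rewrite -rmorphXn; apply: contraNneq am => /(congr1 (fun X : 'M[R]_1 => X ord0 ord0)).
by rewrite /= -[1 in X in X -> _]/(1%:M) !mxE eqxx !mulr1n => ->.
Qed.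
End LinearGroupElements.

(** * One-dimensional groups and the theorem *)

Section WittUnits.
Variables (p k : nat) (p_pr : prime p) (r : nat) (K : finFieldType).
Hypothesis cardK : #|K| = (p ^ k)%N.
Local Notation W := (witt p_pr r K).
Local Notation N := (k * r.-1.+1)%N.

Lemma witt_one_unit_order (y : W) (i : nat) : (0 < i)%N ->
  (1 + y *+ p ^ i) ^+ (p ^ N) = 1.
Proof.
case: i => // i _.
have [||c e] := @eqmodn_exprpn p p_pr W 1 N (1 + y *+ p ^ i.+1) 1 => //.
  by exists (y *+ p ^ i); rewrite -mulrnA -expnSr.
by rewrite e expr1n add1n expnSr mulrnA (witt_mulrn_card cardK) mul0rn addr0.
Qed.

Lemma witt_one_unit_neq1 (y : W) (i j : nat) : (0 < i)%N ->
    (2 < p)%N || (1 < i)%N -> (i + j < r.-1.+1)%N -> wcoord y ord0 != 0 ->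
  (1 + y *+ p ^ i) ^+ (p ^ j) != 1.
Proof.
move=> i_gt0 pi ij y0; have pK := pchar_of_card p_pr cardK.
have [c ->] := expr1D_pmul j p_pr i_gt0 pi y.
rewrite -subr_eq0 addrAC subrr add0r (witt_mulrn_neq0 pK) //.
by rewrite wcoord0D wcoord0_mulrn (mulrn_pchar pK) addr0.
Qed.
End WittUnits.

Lemma expr1D_double (R : comNzRingType) (z : R) (p : nat) : p = 2%N ->
  (1 + z *+ p) ^+ p = 1 + (z + z * z) *+ p ^ 2.
Proof.
move=> ->; rewrite sqrrD expr1n mul1r -mulrnA -addrA; congr (1 + _).
by rewrite exprMn_n mulrnDl expr2.
Qed.

Lemma leq_exp_add2 (p s : nat) : (1 < p)%N -> (s.+4 <= p ^ s.+2)%N.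
Proof.
move=> p_gt1; apply: (@leq_trans (2 ^ s.+2)); last by rewrite leq_exp2r.
by elim: s => // s IH; rewrite expnS; lia.
Qed.

(** For odd [p] take [1 + p].  For [p = 2] write [(1 + 2 z) ^ 2 = 1 + 4 (z + z^2)] and
    choose [z] whose residue [y] satisfies [y + y^2 != 0]; such a [y] exists unless the
    residue field has two elements, when [1 + 4] is the best choice and loses one
    more factor [2].  This loss is affordable for [r >= 6]. *)
Lemma witt_GL1_pelt (p k : nat) (p_pr : prime p) (r : nat) (K : finFieldType)
    (cardK : #|K| = (p ^ k)%N) (k_gt0 : (0 < k)%N) :
    ((r == 3) && (2 < p) || (4 <= r))%N ->
    ~~ ((p ^ k == 2) && ((r == 4) || (r == 5)))%N ->
  exists2 m, (r <= p ^ m)%N &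
  exists u : subg_of (points GL 1 (witt p_pr r K)), (p.-elt u)%g /\ (u ^+ (p ^ m) != 1)%g.
Proof.
move=> rp nexc; have p_gt1 := prime_gt1 p_pr.
have r_gt2 : (2 < r)%N by case/orP: rp => [/andP[/eqP->]|/ltnW].
have Er : (r.-1.+1 = r)%N by lia.
have pK := pchar_of_card p_pr cardK.
have w1 : wcoord (1 : witt p_pr r K) ord0 != 0 by rewrite ffunE oner_neq0.
have r_le : (r <= p ^ r.-2)%N.
  case/orP: rp => [/andP[/eqP-> ?]|]; first by rewrite expn1.
  by case: (r) => [|[|[|[|s]]]] // _; exact: leq_exp_add2.
have [p2|p2] := ltnP 2%N p.
  exists r.-2 => //.
  apply: (points_scalar_pelt p_pr (witt_one_unit_order cardK 1 (i := 1%N) isT)).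
  by apply: (witt_one_unit_neq1 cardK) => //; lia.
have {p2} p2 : p = 2%N by lia.
have r_gt3 : (3 < r)%N by case/orP: rp => // /andP[_]; rewrite p2.
have [k_gt1|k_le1] := ltnP 1%N k.
  exists r.-2 => //.
  have [y /andP[y0 y1]] : exists y : K, (y != 0) && (y != -1).
    apply/existsP; apply: contraT => /existsPn yP.
    have : (#|K| <= #|([set 0; -1 : K])%R|)%N.
      rewrite -cardsT subset_leq_card //; apply/subsetP => y _; rewrite !inE.
      by have := yP y; rewrite negb_and !negbK.
    rewrite cardK p2 cards2; case: (k) k_gt1 => [|[|k']] // _.
    by rewrite !expnS; have := expn_gt0 2 k'; case: (_ != _) => /=; lia.
  pose z : witt p_pr r K := Witt p_pr [ffun=> y].
  have z0 : wcoord z ord0 = y by rewrite ffunE.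
  apply: (points_scalar_pelt p_pr (witt_one_unit_order cardK z (i := 1%N) isT)).
  have -> : (p ^ r.-2 = p * p ^ (r - 3))%N by rewrite -expnS; congr (p ^ _)%N; lia.
  rewrite exprM; have -> : (1 + z *+ p ^ 1) ^+ p = 1 + (z + z * z) *+ p ^ 2.
    exact: expr1D_double.
  apply: (witt_one_unit_neq1 cardK) => //; first by rewrite orbT.
    by lia.
  rewrite wcoord0D wcoord0M z0 -[X in X + _]mulr1 -mulrDr mulf_neq0 //.
  by rewrite addrC addr_eq0.
have Ek : k = 1%N by lia.
rewrite p2 Ek /= in nexc.
exists (r - 3)%N.
  have : (5 < r)%N by move: nexc; case: (r) r_gt3 => [|[|[|[|[|[|?]]]]]].
  rewrite p2; case: (r) => [|[|[|[|[|[|s]]]]]] // _; rewrite !subSS subn0.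
  by elim: s => // s IH; rewrite expnS; lia.
apply: (points_scalar_pelt p_pr (witt_one_unit_order cardK 1 (i := 2%N) isT)).
by apply: (witt_one_unit_neq1 cardK) => //; rewrite ?orbT //; lia.
Qed.

Theorem theoremA (p : nat) (p_pr : prime p) (k : nat) (k_gt0 : (0 < k)%N)
    (q : nat) (q_pow : q = (p ^ k)%N) (Fq : finFieldType) (card_Fq : #|Fq| = q)
    (n r : nat) (n_gt0 : (0 < n)%N) (r_gt0 : (0 < r)%N) (G : linear_group)
    (nexc : ~~ rank_one_exception G n r q)
    (F : fieldType) (pcharF : p \in [pchar F]) (perfF : perfect F)
    (p_ge_n : (n <= p)%N)
    (rp : [\/ r = 2%N /\ (2 * n <= p)%N,
              r = 3%N /\ (3 <= p)%N
            | (4 <= r)%N /\ (2 <= p)%N]) :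
  ~ stably_equivalent_of_Morita_type
      (group_algebra F (points G n (witt p_pr r Fq)))
      (group_algebra F (points G n {poly %/ ('X^r : {poly Fq})})).
Proof.
move=> stab; rewrite q_pow in card_Fq nexc.
have pFq := pchar_of_card p_pr card_Fq.
have [m nr [u [u_p um]]] : exists2 m, (n * r <= p ^ m)%N &
  exists u : subg_of (points G n (witt p_pr r Fq)),
    (p.-elt u)%g /\ (u ^+ (p ^ m) != 1)%g.
  have [n_gt1|n_le1] := ltnP 1%N n.
    exists r.-1.
      case: rp => [[-> le]|[-> p3]|[r4 _]]; first by rewrite expn1 mulnC.
        by rewrite /= expnS expn1 leq_mul.
      case: (r) r4 => [|[|[|[|s]]]] // _; rewrite [X in (_ <= X)%N]expnS leq_mul //.
      exact/leq_exp_add2/prime_gt1.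
    apply: (@points_transvection_pelt p (k * r.-1.+1) _ p_pr) => //.
      exact: witt_mulrn_card.
    apply: (witt_mulrn_neq0 pFq) => //; by rewrite ffunE oner_neq0.
  have En : n = 1%N by lia.
  rewrite En in nexc *.
  case: G stab nexc => // stab nexc; rewrite mul1n.
  apply: (witt_GL1_pelt p_pr card_Fq k_gt0); move: nexc; rewrite /rank_one_exception /=.
    case: rp => [[->]|[-> ->]|[-> _]] //; by rewrite orbT.
  by rewrite negb_or => /andP[].
have /eqP[] := um; apply: (stable_Morita_pexponent pcharF stab) => // h.
exact: (qpoly_pexponent pFq n_gt0 r_gt0 h nr).
Qed.
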